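(* Let $\mathbb{T}$ be a time scale, $a,b\in\mathbb{T}$ with $a<b$, let $\alpha,\beta,\Lambda$ be prescribed real numbers, and let $f,g:[a,b]\times\mathbb{R}\times\mathbb{R}\to\mathbb{R}$, $(t,x,v)\mapsto f(t,x,v)$ and $(t,x,v)\mapsto g(t,x,v)$, have continuous partial derivatives $f_x,f_v,g_x,g_v$ with respect to the second and third variables. Let $y\in\mathcal{C}^1([a,b],\mathbb{R})$, and suppose that $y$ gives a local minimum or a local maximum to the functional $$I[y]=\int_a^b f(t,y^\rho(t),y^\nabla(t))\,\nabla t$$ subject to the boundary conditions $y(a)=\alpha$, $y(b)=\beta$ and the integral constraint $$J[y]=\int_a^b g(t,y^\rho(t),y^\nabla(t))\,\nabla t=\Lambda .$$ If $y$ is not an extremal for $J$, then there exists a real number $\lambda$ such that, with $F=f-\lambda g$, $$F_v^\nabla(t,y^\rho(t),y^\nabla(t))-F_x(t,y^\rho(t),y^\nabla(t))=0$$ for all $t\in[a,b]_\kappa$.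
   Context: A time scale $\mathbb{T}$ is a nonempty closed subset of $\mathbb{R}$. Throughout, $[a,b]$ denotes $[a,b]\cap\mathbb{T}$, itself regarded as a time scale on which the operators below are taken. The backward jump operator is $\rho(t)=\sup\{s\in[a,b]: s<t\}$ for $t\neq a$, and $\rho(a)=a$. The forward jump operator is $\sigma(t)=\inf\{s\in[a,b]:s>t\}$ for $t\ne b$, and $\sigma(b)=b$. The point $a$ is right-scattered if $\sigma(a)>a$; $[a,b]_\kappa=[a,b]\setminus\{a\}$ if $a$ is right-scattered, and $[a,b]_\kappa=[a,b]$ otherwise. A function $h:[a,b]\to\mathbb{R}$ is nabla differentiable at $t\in[a,b]_\kappa$ if there is a number $h^\nabla(t)$ (the nabla derivative) such that for every $\epsilon>0$ there is a neighborhood $U$ of $t$ in $[a,b]$ with $|h(\rho(t))-h(s)-h^\nabla(t)(\rho(t)-s)|\le\epsilon|\rho(t)-s|$ for all $s\in U$. Notation: $h^\rho=h\circ\rho$. $\mathcal{C}^1([a,b],\mathbb{R})$ is the set of $y:[a,b]\to\mathbb{R}$ such that $y^\nabla$ exists and is continuous on $[a,b]_\kappa$. A nabla antiderivative of $h$ is a function $H$ with $H^\nabla(t)=h(t)$ for all $t\in[a,b]_\kappa$, and the nabla integral is $\int_r^s h(t)\nabla t=H(s)-H(r)$. $F_x,F_v$ are the partial derivatives of $F(t,x,v)$ with respect to the second and third variables, and $F_v^\nabla(t,y^\rho(t),y^\nabla(t))$ denotes the nabla derivative at $t$ of the composite function $t\mapsto F_v(t,y^\rho(t),y^\nabla(t))$.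 Local extremum: a function $y\in\mathcal{C}^1([a,b],\mathbb{R})$ satisfying the boundary conditions and the integral constraint gives a local minimum (respectively local maximum) if there is $\delta>0$ such that $I[y]\le I[\hat y]$ (respectively $I[y]\ge I[\hat y]$) for all $\hat y\in\mathcal{C}^1([a,b],\mathbb{R})$ satisfying $\hat y(a)=\alpha$, $\hat y(b)=\beta$, $J[\hat y]=\Lambda$ and $\|\hat y^\rho-y^\rho\|+\|\hat y^\nabla-y^\nabla\|<\delta$, where $\|h\|=\sup_{t\in[a,b]_\kappa}|h(t)|$. Extremal for $J$: $y\in\mathcal{C}^1([a,b],\mathbb{R})$ is an extremal for $J$ if there is a constant $c$ such that $g_v(t,y^\rho(t),y^\nabla(t))-\int_a^t g_x(\tau,y^\rho(\tau),y^\nabla(\tau))\nabla\tau=c$ for all $t\in[a,b]_\kappa$.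
   Formalization: If a is right-scattered, y^∇(a) and so F_v along y at a are undefined though needed for the nabla derivative at σ(a); the conclusion is stated for some extension of t↦F_v(t,y^ρ(t),y^∇(t)) from [a,b]_κ to [a,b], with the value at a free. *)

(* Defs.v *)
From HB Require Import structures.
From mathcomp Require Import all_boot all_order all_algebra.
From mathcomp Require Import all_classical all_reals all_analysis.
Import Order.TTheory GRing.Theory Num.Theory.
Import numFieldNormedType.Exports.

Set Implicit Arguments.
Unset Strict Implicit.
Unset Printing Implicit Defensive.

Local Open Scope classical_set_scope.
Local Open Scope ring_scope.

(* Functions on a time scale are represented by total
   functions on R of which only the values on the relevant set ([a, b] or
   [a, b]_kappa) are ever used. *)

Definition is_time_scale (R : realType) (T : set R) : Prop :=
  T !=set0 /\ closed T.

Definition ts_itv (R : realType) (T : set R) (a b : R) : set R :=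
  T `&` `[a, b].

Definition ts_rho (R : realType) (T : set R) (a b t : R) : R :=
  if t == a then a else sup [set s | ts_itv T a b s /\ s < t].

Definition ts_sigma (R : realType) (T : set R) (a b t : R) : R :=
  if t == b then b else inf [set s | ts_itv T a b s /\ s > t].

Definition ts_kappa (R : realType) (T : set R) (a b : R) : set R :=
  if a < ts_sigma T a b a then ts_itv T a b `\ a else ts_itv T a b.

Definition is_nabla (R : realType) (T : set R) (a b : R) (h : R -> R)
    (t d : R) : Prop :=
  forall e : R, 0 < e -> \forall s \near within (ts_itv T a b) (nbhs t),
    `|h (ts_rho T a b t) - h s - d * (ts_rho T a b t - s)|
      <= e * `|ts_rho T a b t - s|.

Definition nabla_derivable (R : realType) (T : set R) (a b : R) (h : R -> R)
    (t : R) : Prop :=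
  exists d, is_nabla T a b h t d.

(* The number d is unique for t in [a, b]_kappa; the default value 0 is taken
   where h is not nabla differentiable. *)
Definition nabla (R : realType) (T : set R) (a b : R) (h : R -> R)
    (t : R) : R :=
  xget 0 [set d | is_nabla T a b h t d].

Definition C1 (R : realType) (T : set R) (a b : R) (y : R -> R) : Prop :=
  (forall t, ts_kappa T a b t -> nabla_derivable T a b y t) /\
  {within ts_kappa T a b, continuous (nabla T a b y)}.

Definition nabla_antiderivative (R : realType) (T : set R) (a b : R)
    (h H : R -> R) : Prop :=
  forall t, ts_kappa T a b t -> is_nabla T a b H t (h t).

Definition nabla_integrable (R : realType) (T : set R) (a b : R)
    (h : R -> R) : Prop :=
  exists H, nabla_antiderivative T a b h H.

(* The value H s - H r does not depend on the antiderivative H; the default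
   value 0 is taken when h has no nabla antiderivative. *)
Definition nabla_int (R : realType) (T : set R) (a b : R) (h : R -> R)
    (r s : R) : R :=
  xget 0 [set v | exists2 H, nabla_antiderivative T a b h H & v = H s - H r].

Definition partial_x (R : realType) (L : R -> R -> R -> R) (t x v : R) : R :=
  derive1 (fun u => L t u v) x.

Definition partial_v (R : realType) (L : R -> R -> R -> R) (t x v : R) : R :=
  derive1 (fun w => L t x w) v.

(* No regularity of t |-> L t x v itself is required. *)
Definition C1_lagrangian (R : realType) (T : set R) (a b : R)
    (L : R -> R -> R -> R) : Prop :=
  [/\ forall t x v, ts_itv T a b t -> derivable (fun u => L t u v) x 1,
      forall t x v, ts_itv T a b t -> derivable (fun w => L t x w) v 1,
      {within [set p : R * R * R | ts_itv T a b p.1.1],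
        continuous (fun p : R * R * R => partial_x L p.1.1 p.1.2 p.2)} &
      {within [set p : R * R * R | ts_itv T a b p.1.1],
        continuous (fun p : R * R * R => partial_v L p.1.1 p.1.2 p.2)}].

Definition along (R : realType) (T : set R) (a b : R) (L : R -> R -> R -> R)
    (y : R -> R) (t : R) : R :=
  L t (y (ts_rho T a b t)) (nabla T a b y t).

Definition functional (R : realType) (T : set R) (a b : R)
    (L : R -> R -> R -> R) (y : R -> R) : R :=
  nabla_int T a b (along T a b L y) a b.

Definition kappa_norm (R : realType) (T : set R) (a b : R) (h : R -> R) : R :=
  sup [set `|h t| | t in ts_kappa T a b].

Definition C1_dist (R : realType) (T : set R) (a b : R) (z y : R -> R) : R :=
  kappa_norm T a b (fun t => z (ts_rho T a b t) - y (ts_rho T a b t)) +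
  kappa_norm T a b (fun t => nabla T a b z t - nabla T a b y t).

(* As [functional] is total, the existence of the integrals I[y] and J[y] is
   recorded separately.  When f and g satisfy C1_lagrangian, it holds for all
   y of class C1 as soon as it holds for one of them. *)
Definition admissible (R : realType) (T : set R) (a b alpha beta Lambda : R)
    (g : R -> R -> R -> R) (y : R -> R) : Prop :=
  [/\ C1 T a b y, y a = alpha, y b = beta,
      nabla_integrable T a b (along T a b g y) &
      functional T a b g y = Lambda].

Definition local_minimum (R : realType) (T : set R)
    (a b alpha beta Lambda : R) (f g : R -> R -> R -> R) (y : R -> R) : Prop :=
  [/\ admissible T a b alpha beta Lambda g y,
      nabla_integrable T a b (along T a b f y) &
      exists2 delta : R, 0 < delta & forall z : R -> R,
        admissible T a b alpha beta Lambda g z ->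
        nabla_integrable T a b (along T a b f z) ->
        C1_dist T a b z y < delta ->
        functional T a b f y <= functional T a b f z].

Definition local_maximum (R : realType) (T : set R)
    (a b alpha beta Lambda : R) (f g : R -> R -> R -> R) (y : R -> R) : Prop :=
  [/\ admissible T a b alpha beta Lambda g y,
      nabla_integrable T a b (along T a b f y) &
      exists2 delta : R, 0 < delta & forall z : R -> R,
        admissible T a b alpha beta Lambda g z ->
        nabla_integrable T a b (along T a b f z) ->
        C1_dist T a b z y < delta ->
        functional T a b f z <= functional T a b f y].

(* When g satisfies C1_lagrangian and y is of class C1, the integrand below is
   ld-continuous, hence has a nabla antiderivative. *)
Definition extremal (R : realType) (T : set R) (a b : R)
    (g : R -> R -> R -> R) (y : R -> R) : Prop :=
  C1 T a b y /\
  exists c : R, forall t, ts_kappa T a b t ->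
    along T a b (partial_v g) y t
      - nabla_int T a b (along T a b (partial_x g) y) a t = c.

(* The function t |-> F_v(t, y^rho(t), y^nabla(t)) is defined only on
   [a, b]_kappa, whereas its nabla derivative is taken on [a, b].  If a is
   right-scattered, y^nabla(a) is undefined although the nabla derivative at
   sigma(a) involves the value at a; so phi is an extension to [a, b] of the
   given function, the value at a being unconstrained in that case.  If a is
   right-dense, [a, b]_kappa = [a, b] and phi is determined on [a, b]. *)
Definition extends_from_kappa (R : realType) (T : set R) (a b : R)
    (h phi : R -> R) : Prop :=
  forall t, ts_kappa T a b t -> phi t = h t.

(* Main.v *)
Require Import Defs.
From HB Require Import structures.
From mathcomp Require Import all_boot all_order all_algebra.
From mathcomp Require Import all_classical all_reals all_analysis.
From mathcomp Require Import ring lra.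
Import Order.TTheory GRing.Theory Num.Theory.
Import numFieldNormedType.Exports.

Set Implicit Arguments.
Unset Strict Implicit.
Unset Printing Implicit Defensive.

Local Open Scope classical_set_scope.
Local Open Scope ring_scope.
(** Every bounded function that is continuous at left-dense points has a nabla
antiderivative.  Integrating by parts, the first variation of I at y in a
direction eta vanishing at a and b is the integral of (f_v - Q) eta^nabla, with
Q an antiderivative of f_x along y.  If y is not an extremal for J, some eta0
has nonzero first variation of J; correcting y + eps eta by a multiple of eta0
so as to restore the constraint shows that the first variation of I vanishes
wherever that of J does, hence is lambda times it.  The du Bois-Reymond lemma
for F = f - lambda g then says that F_v minus an antiderivative of F_x is
constant on [a, b]_kappa.  Its test functions must have a nabla derivative that
is continuous on [a, b]_kappa, whereas F_v - Q may jump at right-dense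
left-scattered points, so the test function cannot be built directly from it. *)

(** The Lagrangians need not be continuous in [t], so the integrand along a smooth [y] may have no
    antiderivative at all, and no estimate can be made on [f] or [g] alone. What does vary
    continuously with [t] is an increment [L t x' v' - L t x v]: by the mean value theorem it is
    controlled by the partial derivatives, which are uniformly continuous on compact boxes. Hence
    integrability along one C1 function passes to all others, and every expansion is made for a
    difference of two functionals. Boundedness together with continuity at left-dense points is the
    natural class of integrands because [y^rho] is in general continuous only there. The constraint
    is restored without an implicit function theorem: a first-order expansion whose error is small
    relative to the C1 size of the perturbation, and continuity along lines, are enough. Perturbing
    along both [eta] and [-eta] makes I increase once and decrease once, so minima and maxima are
    handled by the same construction. *)

(** * Uniform continuity and mean value estimates *)

Lemma compact_unif_continuous (R : realType) (U : pseudoMetricType R) (A : set U)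
    (h : U -> R) : compact A -> {within A, continuous h} ->
  forall e : R, 0 < e -> exists2 d : R, 0 < d &
    forall p q, A p -> A q -> ball p d q -> `|h p - h q| <= e.
Proof.
move=> /compact_near_coveringP cA /subspace_continuousP ch e e0.
have e20 : 0 < e / 2 by lra.
pose P (d : R) (p : U) := A p -> forall q, A q -> ball p d q -> `|h p - h q| <= e.
have [] := cA _ (0^'+) P _; last first.
  move=> d /= d0 Pd; exists (d / 2); first lra.
  move=> p q Ap Aq pq; apply: (Pd (d / 2)) => //; last lra.
  by rewrite /ball_ /= sub0r normrN gtr0_norm; lra.
move=> p Ap; have /cvgrPdist_le/(_ _ e20)/nbhs_ballP[r /= r0 Hr] := ch p Ap.
exists (ball p (r / 2), [set d | d < r / 2]) => /=.
  by split; [apply: nbhsx_ballx; lra|apply: nbhs_right_lt; lra].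
move=> [q d] /= [pq dr] Aq s As qs.
have h1 := Hr q (le_ball (_ : r / 2 <= r) pq) Aq.
have h2 : `|h p - h s| <= e / 2.
  apply: Hr As; apply: (@le_ball _ _ _ (r / 2 + d)); first lra.
  exact: ball_triangle qs.
have -> : h q - h s = (h p - h s) - (h p - h q) by ring.
apply: le_trans (ler_normB _ _) _; have := h1 ltac:(lra); lra.
Qed.

Lemma continuous_within_bounded (R : realType) (U : topologicalType) (A : set U) (h : U -> R) :
  compact A -> {within A, continuous h} -> exists M, forall x, A x -> `|h x| <= M.
Proof.
move=> cA ch; have /compact_bounded[M [_ HM]] := continuous_compact ch cA.
by exists (M + 1) => x Ax; apply: (HM (M + 1)); [lra|exists x].
Qed.

Lemma mvt_norm_le (R : realType) (h dh : R -> R) (c r e x y : R) :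
  (forall u : R, is_derive u 1 h (dh u)) ->
  (forall u, `|u - c| <= r -> `|dh u| <= e) ->
  `|x - c| <= r -> `|y - c| <= r -> `|h y - h x| <= e * `|y - x|.
Proof.
move=> dhP dhe; wlog xy : x y / x <= y => [W xc yc|].
  have [|/ltW] := leP x y => xy; first exact: W.
  by rewrite distrC [`|y - x|]distrC; exact: W.
move=> xc yc.
have [|u] := @MVT_segment _ h dh x y xy (fun u _ => dhP u).
  by apply: derivable_within_continuous => u _; case: (dhP u).
rewrite in_itv /= => /andP[xu uy] ->; rewrite normrM ler_wpM2r// dhe//.
by move: xc yc; rewrite !ler_norml; lra.
Qed.

(** One variable is changed at a time, through the corner [(x, v')], which stays in the box; thus
    only partial derivatives enter, never joint differentiability. *)
Lemma mvt2_norm_le (R : realType) (h hx hv : R -> R -> R) (c k r e x v x' v' : R) :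
  (forall u w : R, is_derive u 1 (h^~ w) (hx u w)) ->
  (forall u w : R, is_derive w 1 (h u) (hv u w)) ->
  (forall u w, `|u - c| <= r -> `|w - k| <= r -> `|hx u w| <= e /\ `|hv u w| <= e) ->
  `|x - c| <= r -> `|v - k| <= r -> `|x' - c| <= r -> `|v' - k| <= r ->
  `|h x' v' - h x v| <= e * (`|x' - x| + `|v' - v|).
Proof.
move=> hxP hvP he xc vk xc' vk'.
have -> : h x' v' - h x v = (h x' v' - h x v') + (h x v' - h x v) by ring.
apply: le_trans (ler_normD _ _) _; rewrite mulrDr; apply: lerD.
  apply: (@mvt_norm_le _ (h^~ v') (hx^~ v') c r) => // u uc.
  by have [] := he u v' uc vk'.
apply: (@mvt_norm_le _ (h x) (hv x) k r) => // w wk.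
by have [] := he x w xc wk.
Qed.

Lemma is_derive_affine (R : realType) (k l u : R) :
  is_derive u 1 (fun u : R => k * u + l) k.
Proof. by apply: is_derive_eq; rewrite addr0 scaler1. Qed.

Lemma near_within_ballP (R : realType) (A : set R) (t : R) (P : R -> Prop) :
  (\forall s \near within A (nbhs t), P s) <->
  exists2 d : R, 0 < d & forall s, A s -> `|t - s| < d -> P s.
Proof.
split.
  move=> /nbhs_ballP[d /= d0 dP]; exists d => // s As ts.
  exact: (dP s ts As).
move=> [d d0 dP]; apply/nbhs_ballP; exists d => //= s ts As.
exact: dP.
Qed.

Lemma cvg_within_ballP (R : realType) (A : set R) (t : R) (h : R -> R) (l : R) :
  h @ within A (nbhs t) --> l <->
  forall e : R, 0 < e -> exists2 d : R, 0 < d &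
    forall s, A s -> `|t - s| < d -> `|l - h s| <= e.
Proof.
split=> [/cvgrPdist_le hl e e0|hl].
  by have /near_within_ballP := hl e e0.
by apply/cvgrPdist_le => e e0; apply/near_within_ballP/hl.
Qed.

(** * The backward jump operator and the set [a, b]_kappa *)

Section TimeScale.
Variables (R : realType) (T : set R) (a b : R).
Hypotheses (hT : is_time_scale T) (ha : T a) (hb : T b) (hab : a < b).

Local Notation X := (ts_itv T a b).
Local Notation K := (ts_kappa T a b).
Local Notation rho := (ts_rho T a b).
Local Notation isn := (is_nabla T a b).

Lemma ts_itvP t : X t <-> [/\ T t, a <= t & t <= b].
Proof.
rewrite /ts_itv /=; split=> [[Tt]|[Tt at_ tb]]; last by split=> //=; rewrite in_itv /= at_ tb.
by rewrite /= in_itv /= => /andP[].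
Qed.

Lemma ts_itv_left : X a.
Proof. by apply/ts_itvP; split=> //; exact: ltW. Qed.

Lemma ts_itv_right : X b.
Proof. by apply/ts_itvP; split=> //; exact: ltW. Qed.

Lemma ts_itv_ge t : X t -> a <= t. Proof. by case/ts_itvP. Qed.

Lemma ts_itv_le t : X t -> t <= b. Proof. by case/ts_itvP. Qed.

Lemma ts_itv_compact : compact X.
Proof.
rewrite /ts_itv setIC.
apply: (subclosed_compact _ (@segment_compact R a b)); last exact: subIsetl.
apply: closedI; last by case: hT.
exact: itv_closed.
Qed.

Lemma ts_itv_closed : closed X.
Proof. by apply: closedI; [case: hT|exact: itv_closed]. Qed.

Lemma rho_le t : X t -> rho t <= t.
Proof.
move=> Xt; rewrite /ts_rho; case: eqVneq => [->//|ta].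
apply: ge_sup; last by move=> s /= [_ /ltW].
exists a; split; first exact: ts_itv_left.
by rewrite lt_neqAle eq_sym ta (ts_itv_ge Xt).
Qed.

Lemma le_rho s t : X s -> s < t -> s <= rho t.
Proof.
move=> Xs st; rewrite /ts_rho; case: eqVneq => [ta|ta].
  by rewrite -ta; exact: ltW.
apply: ub_le_sup => //; exists t => u /= [_ /ltW //].
Qed.

Lemma rho_mem t : X t -> X (rho t).
Proof.
move=> Xt; rewrite /ts_rho; case: eqVneq => [_|ta]; first exact: ts_itv_left.
apply: ts_itv_closed.
set A := (X in sup X).
have : closure A (sup A).
  apply: closure_sup.
    exists a; split; first exact: ts_itv_left.
    by rewrite lt_neqAle eq_sym ta (ts_itv_ge Xt).
  by exists t => u /= [_ /ltW].
by apply: closure_subset => u [].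
Qed.

Lemma left_dense t e : X t -> t <> a -> rho t = t -> 0 < e ->
  exists s, [/\ X s, t - e < s & s < t].
Proof.
move=> Xt /eqP ta rt e0; move: rt; rewrite /ts_rho (negPf ta).
set A := [set s | _ ] => supA.
have hA : has_sup A.
  split; last by exists t => u /= [_ /ltW].
  exists a; split; first exact: ts_itv_left.
  by rewrite lt_neqAle eq_sym ta (ts_itv_ge Xt).
have [s [Xs st] es] := sup_adherent e0 hA.
by exists s; split=> //; move: es; rewrite supA.
Qed.

Lemma kappaP t : K t <-> X t /\
  (t = a -> forall e : R, 0 < e -> exists s, [/\ X s, a < s & s < a + e]).
Proof.
rewrite /ts_kappa /ts_sigma (lt_eqF hab).
set A := [set s | _ ].
have Ab : A b by split=> //; exact: ts_itv_right.
have hA : has_inf A by split; [exists b|exists a => u /= [_ /ltW]].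
case: ifPn => [aA|].
  split=> [[Xt ta]|[Xt h]]; first by split=> // /ta.
  split=> // /= ta; have [|s [Xs as_ sA]] := h ta (inf A - a).
    by rewrite subr_gt0.
  have : inf A <= s by apply: (ge_inf (proj2 hA)).
  lra.
rewrite -leNgt => Aa; split=> [Xt|[]//]; split=> // _ e e0.
have [s [Xs as_] es] := inf_adherent e0 hA.
exists s; split=> //; lra.
Qed.

Lemma kappa_sub t : K t -> X t. Proof. by case/kappaP. Qed.

Lemma kappa_gt t : X t -> a < t -> K t.
Proof. by move=> Xt at_; apply/kappaP; split=> // ta; move: at_; rewrite ta ltxx. Qed.

Lemma kappa_right : K b.
Proof. by apply: kappa_gt => //; exact: ts_itv_right. Qed.

Lemma not_kappa_left : ~ K a -> exists2 d : R, 0 < d & forall s, X s -> s = a \/ a + d <= s.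
Proof.
move=> Ka; apply: contrapT => h; apply: Ka; apply/kappaP; split=> [|_ e e0].
  exact: ts_itv_left.
apply: contrapT => h'; apply: h; exists e => // s Xs.
have [->|sa] := eqVneq s a; first by left.
right; rewrite leNgt; apply/negP => sae; apply: h'; exists s; split=> //.
by rewrite lt_neqAle eq_sym sa (ts_itv_ge Xs).
Qed.

Lemma rho_scattered t : X t -> rho t != t -> rho t < t.
Proof. by move=> Xt rt; rewrite lt_neqAle rt (rho_le Xt). Qed.

(** This is what makes the nabla derivative unique on [a, b]_kappa. At a right-scattered [a] the
    only nearby point is [a = rho a], and every number would be a derivative. *)
Lemma kappa_slope_point t d : K t -> 0 < d ->
  exists s, [/\ X s, s <> rho t & `|t - s| < d].
Proof.
move=> Kt d0; have Xt := kappa_sub Kt.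
have [rt|/(rho_scattered Xt) rt] := eqVneq (rho t) t; last first.
  exists t; split=> //; last by rewrite subrr normr0.
  by move=> E; move: rt; rewrite -E ltxx.
have [ta|/eqP ta] := eqVneq t a.
  have [_ /(_ ta d d0)[s [Xs as_ sd]]] := (kappaP t).1 Kt.
  exists s; split=> //; rewrite ?rt; first lra.
  by rewrite ta distrC ger0_norm; lra.
have [s [Xs sd st]] := left_dense Xt ta rt d0.
exists s; split=> //; rewrite ?rt; first lra.
by rewrite ger0_norm; lra.
Qed.

(** * The nabla derivative as a limit of difference quotients *)

Lemma is_nabla_ballP h t d : isn h t d <->
  forall e : R, 0 < e -> exists2 D : R, 0 < D & forall s, X s -> `|t - s| < D ->
  `|h (rho t) - h s - d * (rho t - s)| <= e * `|rho t - s|.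
Proof.
by split=> H e e0; have := H e e0; rewrite near_within_ballP.
Qed.

Let slope (h : R -> R) t s := (h (rho t) - h s) / (rho t - s).
Let SF t := within (X `\ rho t) (nbhs t).

Lemma slope_filter_proper t : K t -> ProperFilter (SF t).
Proof.
move=> Kt; split; last exact: within_filter.
move=> /near_within_ballP[d d0 /=].
have [s [Xs sr st]] := kappa_slope_point Kt d0.
by move/(_ s (conj Xs sr) st).
Qed.

(** At [s = rho t] the defining inequality reads [0 <= 0], so that point can be removed; limit
    calculus then gives the sum and product rules. *)
Lemma is_nabla_slope h t d : K t -> isn h t d <-> slope h t @ SF t --> d.
Proof.
move=> Kt; rewrite is_nabla_ballP /SF cvg_within_ballP.
split=> H e e0; have [D D0 HD] := H e e0; exists D => // s.
  move=> [Xs /eqP sr] ts; have r0 : rho t - s != 0 by rewrite subr_eq0 eq_sym.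
  have := HD s Xs ts; rewrite -ler_pdivrMr ?normr_gt0// -normf_div.
  by rewrite distrC mulrBl mulfK.
move=> Xs ts; have [->|sr] := eqVneq s (rho t).
  by rewrite !subrr mulr0 subrr normr0 mulr0.
have r0 : rho t - s != 0 by rewrite subr_eq0 eq_sym.
have := HD s (conj Xs (elimN eqP sr)) ts.
rewrite -ler_pdivrMr ?normr_gt0// -normf_div distrC /slope.
by rewrite [X in _ -> `|X| <= _]mulrBl mulfK.
Qed.

Lemma is_nabla_unique h t d1 d2 : K t -> isn h t d1 -> isn h t d2 -> d1 = d2.
Proof.
move=> Kt /(is_nabla_slope _ _ Kt) h1 /(is_nabla_slope _ _ Kt) h2.
have PF := slope_filter_proper Kt.
exact: (cvg_unique _ h1 h2).
Qed.

Lemma nablaE h t d : K t -> isn h t d -> nabla T a b h t = d.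
Proof.
move=> Kt hd; rewrite /nabla; case: xgetP => [x _ /= hx|/(_ d) //].
exact: is_nabla_unique hx hd.
Qed.

Lemma nablaP h t : nabla_derivable T a b h t -> isn h t (nabla T a b h t).
Proof. by move=> [d hd]; rewrite /nabla; case: xgetP => // /(_ d). Qed.

Lemma is_nabla_cst c t : isn (fun=> c) t 0.
Proof.
apply/is_nabla_ballP => e e0; exists 1 => // s _ _.
by rewrite subrr mul0r subrr normr0 mulr_ge0 // ltW.
Qed.

Lemma is_nabla_id t : isn id t 1.
Proof.
apply/is_nabla_ballP => e e0; exists 1 => // s _ _.
by rewrite mul1r subrr normr0 mulr_ge0 // ltW.
Qed.

(** Every neighborhood of [t] contains [t], so the defining inequality may be read at [s = t], for
    all [e] at once. *)
Lemma is_nabla_jump h t d : K t -> isn h t d -> h t - h (rho t) = d * (t - rho t).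
Proof.
move=> Kt /is_nabla_ballP H; have Xt := kappa_sub Kt.
have [->|/(rho_scattered Xt) rt] := eqVneq (rho t) t; first by rewrite !subrr mulr0.
have n0 : 0 < t - rho t by rewrite subr_gt0.
apply/eqP; rewrite -subr_eq0 -normr_le0; apply/ler_addgt0Pr => u u0.
have [D' D'0 HD'] := H _ (divr_gt0 u0 n0).
rewrite add0r.
have -> : h t - h (rho t) - d * (t - rho t) = - (h (rho t) - h t - d * (rho t - t)) by ring.
rewrite normrN; apply: le_trans (HD' t Xt _) _; first by rewrite subrr normr0.
by rewrite distrC (gtr0_norm n0) divfK// lt0r_neq0.
Qed.

Lemma is_nabla_continuous h t d : K t -> isn h t d ->
  h @ within X (nbhs t) --> h t.
Proof.
move=> Kt /is_nabla_ballP H; apply/cvg_within_ballP => e e0.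
have [D D0 HD] := H 1 ltr01.
have Xt := kappa_sub Kt; have rt := rho_le Xt.
have c0 : 0 < 1 + `|d| by rewrite ltr_pwDl.
have E s : X s -> `|t - s| < D -> `|h (rho t) - h s - d * (rho t - s)| <= `|rho t - s|.
  by move=> Xs ts; have := HD s Xs ts; rewrite mul1r.
have [{}rt|/(rho_scattered Xt) {}rt] := eqVneq (rho t) t.
  exists (Num.min D (e / (1 + `|d|))); first by rewrite lt_min D0 divr_gt0.
  move=> s Xs; rewrite lt_min => /andP[/(E s Xs)].
  rewrite rt => h1; rewrite ltr_pdivlMr // [X in X < _]mulrDr mulr1 => h2.
  have -> : h t - h s = (h t - h s - d * (t - s)) + d * (t - s) by ring.
  apply: le_trans (ler_normD _ _) _; rewrite normrM [`|d| * _]mulrC.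
  by apply: le_trans (ltW h2); rewrite lerD2r.
have n0 : 0 < t - rho t by rewrite subr_gt0.
have ht := is_nabla_jump Kt ((is_nabla_ballP h t d).2 H).
(* For [|t - s| < 1] one has [|rho t - s| <= t - rho t + 1], so this accuracy leaves an error of at
   most [e / 2]; the term [d * (t - s)] takes the other half. *)
have m0 : 0 < e / (2 * (t - rho t + 1)) by rewrite divr_gt0// mulr_gt0//; lra.
have [D' D'0 HD'] := H _ m0.
exists (Num.min (Num.min D' 1) (e / 2 / (1 + `|d|))).
  by rewrite !lt_min D'0 ltr01 !divr_gt0.
move=> s Xs; rewrite !lt_min => /andP[/andP[tD t1]].
rewrite ltr_pdivlMr // [X in X < _]mulrDr mulr1 => h2.
have := HD' s Xs tD.
have -> : h t - h s = (h (rho t) - h s - d * (rho t - s)) + d * (t - s).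
  by rewrite -[h t](subrK (h (rho t))) ht; ring.
move=> h3; apply: le_trans (ler_normD _ _) _; rewrite normrM.
have h4 : `|rho t - s| <= t - rho t + 1.
  have -> : rho t - s = (rho t - t) + (t - s) by ring.
  by apply: le_trans (ler_normD _ _) _; rewrite distrC (gtr0_norm n0) lerD2l ltW.
have h5 : e / (2 * (t - rho t + 1)) * `|rho t - s| <= e / 2.
  apply: le_trans (ler_wpM2l (ltW m0) h4) _.
  by rewrite le_eqVlt; apply/orP; left; apply/eqP; field; lra.
rewrite mulrC in h2; have := normr_ge0 (t - s); lra.
Qed.

Lemma is_nablaD h1 h2 t d1 d2 : K t -> isn h1 t d1 -> isn h2 t d2 ->
  isn (fun s => h1 s + h2 s) t (d1 + d2).
Proof.
move=> Kt /(is_nabla_slope _ _ Kt) H1 /(is_nabla_slope _ _ Kt) H2.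
apply/(is_nabla_slope _ _ Kt).
have PF := slope_filter_proper Kt.
have -> : slope (fun s => h1 s + h2 s) t = slope h1 t \+ slope h2 t.
  by apply/funext => s; rewrite /slope /= -mulrDl; congr (_ / _); ring.
exact: cvgD.
Qed.

Lemma is_nablaM h1 h2 t d1 d2 : K t -> isn h1 t d1 -> isn h2 t d2 ->
  isn (fun s => h1 s * h2 s) t (d1 * h2 (rho t) + h1 t * d2).
Proof.
move=> Kt H1 /(is_nabla_slope _ _ Kt) H2.
have C1 := is_nabla_continuous Kt H1.
move: H1 => /(is_nabla_slope _ _ Kt) H1.
apply/(is_nabla_slope _ _ Kt).
have PF := slope_filter_proper Kt.
have -> : slope (fun s => h1 s * h2 s) t =
    (fun s => slope h1 t s * h2 (rho t)) \+ (h1 \* slope h2 t).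
  by apply/funext => s; rewrite /slope /=; ring.
have {}C1 : h1 @ SF t --> h1 t.
  move: C1 => /cvg_within_ballP C1; apply/cvg_within_ballP => e e0.
  by have [D D0 HD] := C1 e e0; exists D => // s [Xs _]; exact: HD.
by apply: cvgD; [exact: (cvgMr_tmp H1)|exact: (cvgM C1 H2)].
Qed.

Lemma is_nablaZ c h t d : K t -> isn h t d -> isn (fun s => c * h s) t (c * d).
Proof.
move=> Kt H; have := is_nablaM Kt (is_nabla_cst c t) H.
by rewrite mul0r add0r.
Qed.

(** The only point of [a, b] that [a, b]_kappa can miss is a right-scattered [a], and it is
    isolated. *)
Lemma nabla_derivable_continuous h : (forall t, K t -> nabla_derivable T a b h t) ->
  forall t, X t -> h @ within X (nbhs t) --> h t.
Proof.
move=> dh t Xt; have [ta|ta] := eqVneq t a; last first.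
  have Kt : K t by apply: kappa_gt => //; rewrite lt_neqAle eq_sym ta (ts_itv_ge Xt).
  by have [d] := dh t Kt; exact: is_nabla_continuous.
have [Kt|] := pselect (K t).
  by have [d] := dh t Kt; exact: is_nabla_continuous.
rewrite ta => /not_kappa_left[d d0 Xd].
apply/cvg_within_ballP => e e0; exists d => // s Xs.
have [->|h1] := Xd s Xs; first by move=> _; rewrite subrr normr0 ltW.
by rewrite distrC ger0_norm; lra.
Qed.

(** * Monotonicity and comparison of antiderivatives *)

(** Otherwise let [c] be the least point from [r] on with [h c <= h s]. Then [h > h s] on the points
    of [r, c), and the positive derivative at [c] is contradicted at [rho c] if [c] is
    left-scattered, at points just before [c] if it is left-dense. *)
Lemma nabla_gt0_le h : (forall t, K t -> exists2 d : R, 0 < d & isn h t d) ->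
  forall r s, X r -> X s -> r <= s -> h r <= h s.
Proof.
move=> dh r s Xr Xs rs; rewrite leNgt; apply/negP => hsr.
have ch := @nabla_derivable_continuous h.
have {}ch t : X t -> h @ within X (nbhs t) --> h t.
  by apply: ch => u Ku; have [d _ ?] := dh u Ku; exists d.
pose A := [set u | [/\ X u, r <= u & h u <= h s]].
have hA : has_inf A by split; [exists s|exists r => u []].
have Ai : closure A (inf A).
  move=> B /nbhs_ballP[e /= e0 eB].
  have [u Au ue] := inf_adherent e0 hA.
  exists u; split=> //; apply: eB; rewrite /ball /= distrC ger0_norm; first lra.
  by rewrite subr_ge0; apply: (ge_inf (proj2 hA)).
set c := inf A in Ai.
have Xc : X c by apply: ts_itv_closed; apply: closure_subset Ai => u [].
have rc : r <= c by apply: lb_le_inf; [exists s|move=> u []].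
have lc u : X u -> r <= u -> u < c -> h s < h u.
  move=> Xu ru uc; rewrite ltNge; apply/negP => hu.
  by have : c <= u by [apply: (ge_inf (proj2 hA))]; rewrite leNgt uc.
have hc : h c <= h s.
  apply/ler_addgt0Pr => e e0.
  have [d d0 Hd] := (cvg_within_ballP _ _ _ _).1 (ch c Xc) e e0.
  have [u [[Xu ru hu] uc]] := Ai _ (nbhsx_ballx c _ d0).
  have := Hd u Xu uc; rewrite ler_norml => /andP[_]; lra.
have rc' : r < c by rewrite lt_neqAle rc andbT; apply/eqP => E; move: hsr; rewrite E ltNge hc.
have Kc : K c by apply: kappa_gt => //; apply: le_lt_trans (ts_itv_ge Xr) rc'.
have [d d0 hd] := dh c Kc.
have [rhoc|/(rho_scattered Xc) rhoc] := eqVneq (rho c) c; last first.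
  have := is_nabla_jump Kc hd.
  have := lc _ (rho_mem Xc) (le_rho Xr rc') rhoc.
  have : 0 < d * (c - rho c) by rewrite mulr_gt0 ?subr_gt0.
  lra.
have ca : c <> a by move=> E; have := ts_itv_ge Xr; lra.
have d20 : 0 < d / 2 by lra.
have [D D0 HD] := (is_nabla_ballP _ _ _).1 hd (d / 2) d20.
have m0 : 0 < Num.min D (c - r) by rewrite lt_min D0; lra.
have [u [Xu uc1 uc2]] := left_dense Xc ca rhoc m0.
have := HD u Xu; rewrite rhoc gtr0_norm; last lra.
have : Num.min D (c - r) <= D by rewrite ge_min lexx.
have : Num.min D (c - r) <= c - r by rewrite ge_min lexx orbT.
move=> m1 m2 /(_ ltac:(lra)); rewrite ler_norml => /andP[h1 _].
have ru : r <= u by lra.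
have := lc u Xu ru uc2.
have : 0 <= (d / 2) * (c - u) by apply: mulr_ge0; lra.
lra.
Qed.

Lemma antiderivative_ge0_le h H : nabla_antiderivative T a b h H ->
  (forall t, K t -> 0 <= h t) ->
  forall r s, X r -> X s -> r <= s -> H r <= H s.
Proof.
move=> Hh h0 r s Xr Xs rs; apply/ler_addgt0Pr => e e0.
(* Adding [q * t] makes the derivative positive at a cost [q * (s - r) <= e]; the [+ 1] covers
   [r = s]. *)
pose q := e / (s - r + 1); have q0 : 0 < q by rewrite divr_gt0//; lra.
have G t : K t -> exists2 d : R, 0 < d & isn (fun t => H t + q * t) t d.
  move=> Kt; exists (h t + q * 1); first by rewrite mulr1 ltr_wpDl ?h0.
  by apply: is_nablaD => //; [exact: Hh|apply: is_nablaZ => //; exact: is_nabla_id].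
have := nabla_gt0_le G Xr Xs rs.
have : q * (s - r) <= e.
  by rewrite /q mulrAC ler_pdivrMr ?ler_pM2l; lra.
lra.
Qed.

Lemma antiderivativeD h1 h2 H1 H2 :
  nabla_antiderivative T a b h1 H1 -> nabla_antiderivative T a b h2 H2 ->
  nabla_antiderivative T a b (fun t => h1 t + h2 t) (fun t => H1 t + H2 t).
Proof. by move=> A1 A2 t Kt; apply: is_nablaD => //; [exact: A1|exact: A2]. Qed.

Lemma antiderivativeZ c h H : nabla_antiderivative T a b h H ->
  nabla_antiderivative T a b (fun t => c * h t) (fun t => c * H t).
Proof. by move=> A t Kt; apply: is_nablaZ => //; exact: A. Qed.

Lemma antiderivative_cst c : nabla_antiderivative T a b (fun=> c) (fun t => c * t).
Proof.
move=> t Kt; have := is_nablaZ c Kt (is_nabla_id t).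
by rewrite mulr1.
Qed.

Lemma eq_antiderivative h1 h2 H : (forall t, K t -> h1 t = h2 t) ->
  nabla_antiderivative T a b h1 H -> nabla_antiderivative T a b h2 H.
Proof. by move=> E A t Kt; rewrite -E//; exact: A. Qed.

Lemma antiderivative_le h1 h2 H1 H2 :
  nabla_antiderivative T a b h1 H1 -> nabla_antiderivative T a b h2 H2 ->
  (forall t, K t -> h1 t <= h2 t) ->
  forall r s, X r -> X s -> r <= s -> H1 s - H1 r <= H2 s - H2 r.
Proof.
move=> A1 A2 h12 r s Xr Xs rs.
have A := antiderivativeD A2 (antiderivativeZ (-1) A1).
have : H2 r + -1 * H1 r <= H2 s + -1 * H1 s.
  by apply: (antiderivative_ge0_le A) => // t Kt; have := h12 t Kt; lra.
lra.
Qed.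

Lemma antiderivative_norm_le h H c : nabla_antiderivative T a b h H ->
  (forall t, K t -> `|h t| <= c) ->
  forall r s, X r -> X s -> r <= s -> `|H s - H r| <= c * (s - r).
Proof.
move=> A hc r s Xr Xs rs.
have hc1 t : K t -> h t <= c by move=> Kt; have := hc t Kt; rewrite ler_norml => /andP[].
have hc2 t : K t -> - c <= h t by move=> Kt; have := hc t Kt; rewrite ler_norml => /andP[].
have := antiderivative_le A (antiderivative_cst c) hc1 Xr Xs rs.
have := antiderivative_le (antiderivative_cst (- c)) A hc2 Xr Xs rs.
by rewrite ler_norml; lra.
Qed.

Lemma antiderivative_unique h H1 H2 r s :
  nabla_antiderivative T a b h H1 -> nabla_antiderivative T a b h H2 ->
  X r -> X s -> H1 s - H1 r = H2 s - H2 r.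
Proof.
move=> A1 A2.
have E u v : X u -> X v -> u <= v -> H1 v - H1 u = H2 v - H2 u.
  move=> Xu Xv uv; apply/eqP; rewrite eq_le.
  by rewrite (antiderivative_le A1 A2)// (antiderivative_le A2 A1).
move=> Xr Xs; have [|/ltW] := leP r s; first exact: E.
by move=> /(E _ _ Xs Xr); lra.
Qed.

(** [H] is monotone with equal end values, hence constant, and derivatives are unique; so a
    nonnegative integrand with zero integral vanishes everywhere, without continuity. *)
Lemma antiderivative_ge0_eq0 h H : nabla_antiderivative T a b h H ->
  (forall t, K t -> 0 <= h t) -> H b = H a -> forall t, K t -> h t = 0.
Proof.
move=> A h0 Hba t Kt.
have Hc s : X s -> H s = H a.
  move=> Xs; apply/eqP; rewrite eq_le.
  rewrite (antiderivative_ge0_le A h0 ts_itv_left Xs (ts_itv_ge Xs)) andbT -Hba.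
  exact: (antiderivative_ge0_le A h0 Xs ts_itv_right (ts_itv_le Xs)).
apply: (is_nabla_unique Kt (A t Kt)); apply/is_nabla_ballP => e e0.
exists 1 => // s Xs _; rewrite (Hc s)// (Hc (rho t)); last exact/rho_mem/kappa_sub.
by rewrite mul0r !subrr normr0 mulr_ge0// ltW.
Qed.

Lemma nabla_intE h H r s : nabla_antiderivative T a b h H -> X r -> X s ->
  nabla_int T a b h r s = H s - H r.
Proof.
move=> A Xr Xs; rewrite /nabla_int; case: xgetP => [x _ /= [H' A' ->]|/(_ (H s - H r))].
  exact: antiderivative_unique A' A Xr Xs.
by case; exists H.
Qed.

(** * Existence of antiderivatives *)

(** Boundedness stands in for the right-sided limits of the usual notion. At a left-scattered point
    the derivative of a primitive is the difference quotient over the gap, so continuity matters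
    only where [rho t = t]. *)
Definition ld_continuous (h : R -> R) :=
  (exists M, forall t, K t -> `|h t| <= M) /\
  forall t, K t -> rho t = t -> h @ within K (nbhs t) --> h t.

Let subsolution (h : R -> R) : set (R -> R) := [set k | k a = 0 /\
  forall u w c, X u -> X w -> u < w ->
    (forall x, X x -> u < x -> x <= w -> c <= h x) -> c * (w - u) <= k w - k u].

(** The competitor that bounds the infimum from above: [k] up to [r], slope [C] up to [s], slope [M]
    beyond. A lower bound [c] of [h] on (u, w] never exceeds [M], nor [C] when (u, w] has a point of
    the time scale in (r, s], so each piece grows fast enough. *)
Lemma subsolution_extend h M k r s C : (forall t, K t -> h t <= M) ->
  subsolution h k -> X r -> X s -> r < s ->
  (forall x, X x -> r < x -> x <= s -> h x <= C) ->
  subsolution h (fun t => if t <= r then k t else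
    if t <= s then k r + C * (t - r) else k r + C * (s - r) + M * (t - s)).
Proof.
move=> hM [ka kS] Xr Xs rs hC; split; first by rewrite (ts_itv_ge Xr).
have KX x u : X u -> X x -> u < x -> K x.
  by move=> Xu Xx ux; apply: kappa_gt => //; exact: le_lt_trans (ts_itv_ge Xu) ux.
move=> u w c Xu Xw uw hc.
have cw : c <= M by apply: le_trans (hM w _); [exact: hc|exact: KX uw].
have cC x : X x -> u < x -> x <= w -> r < x -> x <= s -> c <= C.
  by move=> Xx ux xw rx xs; apply: le_trans (hC x _ _ _) => //; exact: hc.
have kr : u <= r -> r <= w -> c * (r - u) <= k r - k u.
  rewrite [u <= r]le_eqVlt => /orP[/eqP -> _|ur rw]; first by rewrite !subrr mulr0.
  by apply: kS => // x Xx ux xr; apply: hc => //; exact: le_trans rw.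
have [wr|rw] := leP w r; first by rewrite (le_trans (ltW uw) wr); exact: kS.
have [ur|ru] := leP u r.
  have {}kr := kr ur (ltW rw).
  have [ws|sw] := leP w s.
    have : c * (w - r) <= C * (w - r) by rewrite ler_wpM2r ?subr_ge0 ?(ltW rw)// (cC w).
    lra.
  have us := le_lt_trans ur rs.
  have : c * (s - r) <= C * (s - r).
    by rewrite ler_wpM2r ?subr_ge0 ?(ltW rs)// (cC s)// ltW.
  have : c * (w - s) <= M * (w - s) by rewrite ler_wpM2r ?subr_ge0 ?(ltW sw).
  lra.
have [ws|sw] := leP w s.
  rewrite (le_trans (ltW uw) ws).
  have : c * (w - u) <= C * (w - u) by rewrite ler_wpM2r ?subr_ge0 ?(ltW uw)// (cC w).
  lra.
have [us|su] := leP u s.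
  have : c * (w - s) <= M * (w - s) by rewrite ler_wpM2r ?subr_ge0 ?(ltW sw).
  move: us; rewrite [u <= s]le_eqVlt => /orP[/eqP ->|us]; first lra.
  have : c * (s - u) <= C * (s - u).
    by rewrite ler_wpM2r ?subr_ge0 ?(ltW us)// (cC s)// ltW.
  lra.
have : c * (w - u) <= M * (w - u) by rewrite ler_wpM2r ?subr_ge0 ?(ltW uw).
lra.
Qed.

(* The antiderivative is the least function that vanishes at a and whose
   increments over (u, w] are at least c (w - u) whenever c <= h there; this
   avoids any theory of integration on the time scale. *)
Lemma exists_primitive h M : (forall t, K t -> `|h t| <= M) ->
  exists H : R -> R, forall u w, X u -> X w -> u < w ->
   (forall c, (forall x, X x -> u < x -> x <= w -> c <= h x) ->
     c * (w - u) <= H w - H u) /\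
   (forall c, (forall x, X x -> u < x -> x <= w -> h x <= c) ->
     H w - H u <= c * (w - u)).
Proof.
move=> hM.
have hM1 t : K t -> h t <= M by move=> /hM; rewrite ler_norml => /andP[].
have hM2 t : K t -> - M <= h t by move=> /hM; rewrite ler_norml => /andP[].
have KX x u : X u -> X x -> u < x -> K x.
  by move=> Xu Xx ux; apply: kappa_gt => //; exact: le_lt_trans (ts_itv_ge Xu) ux.
pose V t := [set k t | k in subsolution h].
have V0 t : V t !=set0.
  exists (M * (t - a)); exists (fun t => M * (t - a)) => //; split.
    by rewrite subrr mulr0.
  move=> u w c Xu Xw uw hc.
  have : c * (w - u) <= M * (w - u).
    rewrite ler_wpM2r ?subr_ge0 ?(ltW uw)//.
    by apply: le_trans (hM1 w _); [exact: hc|exact: KX uw].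
  lra.
have Vlb t : X t -> has_lbound (V t).
  move=> Xt; exists (- M * (t - a)) => _ [k [ka kS] <-].
  move: (ts_itv_ge Xt); rewrite [a <= t]le_eqVlt => /orP[/eqP <-|at_].
    by rewrite ka subrr mulr0.
  have := kS a t (- M) ts_itv_left Xt at_; rewrite ka subr0; apply.
  by move=> x Xx ax _; apply: hM2; exact: kappa_gt.
have Vle t k : X t -> subsolution h k -> inf (V t) <= k t.
  by move=> Xt Sk; apply: (ge_inf (Vlb t Xt)); exists k.
exists (fun t => inf (V t)) => u w Xu Xw uw; split=> c hc.
  rewrite lerBrDr; apply: lb_le_inf => // _ [k Sk <-].
  have := Sk.2 u w c Xu Xw uw hc; have := Vle u k Xu Sk; lra.
(* Replacing [k] after [u] by slope [c] gives a competitor with value [k u + c * (w - u)] at [w];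
   the infimum over [k] gives the bound. *)
rewrite lerBlDr -lerBlDl; apply: lb_le_inf => // _ [k Sk <-].
have := Vle w _ Xw (subsolution_extend hM1 Sk Xu Xw uw hc).
by rewrite /= (lt_geF uw) lexx; lra.
Qed.

Lemma ld_integrable h : ld_continuous h -> nabla_integrable T a b h.
Proof.
move=> [[M hM] hc]; have [H HH] := exists_primitive hM.
have M0 : 0 <= M by apply: le_trans (hM b kappa_right).
have KX x u : X u -> X x -> u < x -> K x.
  by move=> Xu Xx ux; apply: kappa_gt => //; exact: le_lt_trans (ts_itv_ge Xu) ux.
have HM u w : X u -> X w -> `|H u - H w| <= M * `|u - w|.
  wlog uw : u w / u < w => [W Xu Xw|Xu Xw].
    have [uw|wu|->] := ltgtP u w; [exact: W| |by rewrite !subrr normr0 mulr0].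
    by rewrite distrC [`|u - w|]distrC; exact: W.
  have [/(_ (- M)) h1 /(_ M) h2] := HH u w Xu Xw uw.
  rewrite distrC [`|u - w|]distrC (@gtr0_norm _ (w - u)) ?subr_gt0// ler_norml.
  rewrite h2 ?andbT; last first.
    move=> x Xx ux xw; apply: le_trans (hM x _); [exact: ler_norm|exact: KX ux].
  rewrite -mulNr h1// => x Xx ux xw.
  by rewrite lerNl; apply: le_trans (hM x (KX _ _ Xu Xx ux)); rewrite -normrN ler_norm.
exists H => t Kt; apply/is_nabla_ballP => e e0; have Xt := kappa_sub Kt.
have [rt|/(rho_scattered Xt) rt] := eqVneq (rho t) t; last first.
  have n0 : 0 < t - rho t by rewrite subr_gt0.
  have jump : H t - H (rho t) = h t * (t - rho t).
    (* Since (rho t, t] contains only [t], both increment bounds apply with [c = h t] and the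
       increment over the gap is exact. *)
    have only x : X x -> rho t < x -> x <= t -> x = t.
      move=> Xx rx; rewrite [x <= t]le_eqVlt => /orP[/eqP//|xt].
      by have := le_rho Xx xt; rewrite leNgt rx.
    have [h1 h2] := HH _ _ (rho_mem Xt) Xt rt.
    apply/eqP; rewrite eq_le h1 ?h2// => x Xx rx xt; by rewrite (only x Xx rx xt).
  (* The first radius gives [|rho t - s| >= (t - rho t) / 2]; the second makes the error
     [2 * M * |t - s|] at most [e] times that. The [+ 1] allows [M = 0]. *)
  exists (Num.min ((t - rho t) / 2) (e * ((t - rho t) / 2) / (2 * M + 1))).
    by rewrite lt_min !divr_gt0//= ?mulr_gt0 ?divr_gt0//; lra.
  move=> s Xs; rewrite lt_min [X in _ && X]ltr_pdivlMr; last lra.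
  move=> /andP[h1 h2].
  have -> : H (rho t) - H s - h t * (rho t - s) = (H t - H s) - h t * (t - s).
    by rewrite -[H t](subrK (H (rho t))) jump; ring.
  apply: le_trans (ler_normB _ _) _; rewrite normrM.
  have := HM t s Xt Xs.
  have : `|h t| * `|t - s| <= M * `|t - s| by rewrite ler_wpM2r// hM.
  have : (t - rho t) / 2 <= `|rho t - s|.
    rewrite distrC -[s](subrK t); apply: le_trans (ler_norm _).
    by move: h1; rewrite ltr_norml => /andP[]; lra.
  move=> /(ler_wpM2l (ltW e0)); have := normr_ge0 (t - s); lra.
have [D D0 HD] := (cvg_within_ballP _ _ _ _).1 (hc t Kt rt) e e0.
exists D => // s Xs ts; rewrite rt.
have near x : X x -> K x -> `|t - x| <= `|t - s| -> h t - e <= h x <= h t + e.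
  move=> Xx Kx xs; have := HD x Kx (le_lt_trans xs ts).
  by rewrite ler_norml; lra.
have [lts|gts|<-] := ltgtP t s; last by rewrite !subrr mulr0 subrr normr0 mulr0.
  have [/(_ (h t - e)) h1 /(_ (h t + e)) h2] := HH t s Xt Xs lts.
  have nx x : X x -> t < x -> x <= s -> h t - e <= h x <= h t + e.
    move=> Xx tx xs; apply: near => //; first exact: KX tx.
    by rewrite distrC [leRHS]distrC !gtr0_norm ?subr_gt0//; lra.
  have {}h1 := h1 (fun x Xx tx xs => proj1 (andP (nx x Xx tx xs))).
  have {}h2 := h2 (fun x Xx tx xs => proj2 (andP (nx x Xx tx xs))).
  rewrite [in leRHS]distrC (@gtr0_norm _ (s - t)) ?subr_gt0// ler_norml; lra.
have [/(_ (h t - e)) h1 /(_ (h t + e)) h2] := HH s t Xs Xt gts.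
have nx x : X x -> s < x -> x <= t -> h t - e <= h x <= h t + e.
  move=> Xx sx xt; apply: near => //; first exact: KX sx.
  by rewrite !ger0_norm ?subr_ge0//; lra.
have {}h1 := h1 (fun x Xx tx xs => proj1 (andP (nx x Xx tx xs))).
have {}h2 := h2 (fun x Xx tx xs => proj2 (andP (nx x Xx tx xs))).
rewrite (@gtr0_norm _ (t - s)) ?subr_gt0// ler_norml; lra.
Qed.

(** * Stability of ld-continuity *)

Lemma kappa_closed : closed K.
Proof.
move=> t clt.
have Xt : X t by apply: ts_itv_closed; apply: closure_subset clt => s /kappa_sub.
apply: contrapT => nKt.
have ta : t = a.
  apply/eqP/negP => /negP ta; apply: nKt; apply: kappa_gt => //.
  by rewrite lt_neqAle eq_sym ta (ts_itv_ge Xt).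
rewrite ta in nKt clt; have [d d0 Xd] := not_kappa_left nKt.
have [s [Ks sd]] := clt _ (nbhsx_ballx a _ d0).
have [sa|ads] := Xd s (kappa_sub Ks); first by apply: nKt; move: Ks; rewrite sa.
by move: sd; rewrite /ball /= ltr_norml => /andP[sd1 sd2]; lra.
Qed.

Lemma kappa_compact : compact K.
Proof. exact: (subclosed_compact kappa_closed ts_itv_compact (fun t => @kappa_sub t)). Qed.

Lemma ld_continuous_kappa (h : R -> R) : (forall t, K t -> h @ within K (nbhs t) --> h t) ->
  ld_continuous h.
Proof.
move=> ch; split=> [|t Kt _]; last exact: ch.
by apply: continuous_within_bounded kappa_compact _; apply/subspace_continuousP.
Qed.

Lemma cvg_within_subset (A B : set R) (h : R -> R) (t l : R) : B `<=` A ->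
  h @ within A (nbhs t) --> l -> h @ within B (nbhs t) --> l.
Proof.
move=> BA /cvg_within_ballP H; apply/cvg_within_ballP => e e0.
by have [d d0 Hd] := H e e0; exists d => // s /BA; exact: Hd.
Qed.

Lemma rho_continuous_left_dense t : X t -> rho t = t -> rho @ within X (nbhs t) --> t.
Proof.
move=> Xt rt; apply/cvg_within_ballP => e e0.
have [ta|/eqP ta] := eqVneq t a.
  exists e => // s Xs; have := ts_itv_ge (rho_mem Xs); have := rho_le Xs.
  rewrite -ta => h1 h2; rewrite [X in X < _ -> _]distrC [X in _ -> X <= _]distrC.
  by rewrite !ger0_norm; lra.
have [u [Xu ue ut]] := left_dense Xt ta rt e0.
exists (t - u); first lra.
move=> s Xs; rewrite ltr_norml => /andP[h1 h2].
have h3 := rho_le Xs; have us : u < s by lra.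
have h4 := le_rho Xu us.
have [ts|] := leP t s; last by rewrite ler_norml; lra.
have h5 : t <= rho s.
  move: ts; rewrite [t <= s]le_eqVlt => /orP[/eqP <-|]; [by rewrite rt|exact: le_rho].
by rewrite ler_norml; lra.
Qed.

(** At a right-dense left-scattered [t], [rho s] tends to [t] as [s] decreases to [t] while
    [rho t < t]; the composite jumps there unless [h t = h (rho t)]. *)
Lemma ld_continuous_rho (h : R -> R) : (forall t, X t -> h @ within X (nbhs t) --> h t) ->
  ld_continuous (fun t => h (rho t)).
Proof.
move=> ch; split.
  have [|M HM] := continuous_within_bounded ts_itv_compact (_ : {within X, continuous h}).
    exact/subspace_continuousP.
  by exists M => t Kt; apply/HM/rho_mem/kappa_sub.
move=> t Kt rt; rewrite rt; have Xt := kappa_sub Kt.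
apply/cvg_within_ballP => e e0.
have [d d0 Hd] := (cvg_within_ballP _ _ _ _).1 (ch t Xt) e e0.
have d20 : 0 < d / 2 by lra.
have [d' d'0 Hd'] := (cvg_within_ballP _ _ _ _).1 (rho_continuous_left_dense Xt rt) _ d20.
exists d' => // s Ks ts; apply: Hd; first exact/rho_mem/kappa_sub.
by have := Hd' s (kappa_sub Ks) ts; lra.
Qed.

Lemma ld_continuous_cst c : ld_continuous (fun=> c).
Proof.
by split=> [|t _ _]; [by exists (`|c|)|exact: cvg_cst].
Qed.

Lemma ld_continuousD h1 h2 : ld_continuous h1 -> ld_continuous h2 ->
  ld_continuous (fun t => h1 t + h2 t).
Proof.
move=> [[M1 b1] c1] [[M2 b2] c2]; split=> [|t Kt rt].
  exists (M1 + M2) => t Kt; apply: le_trans (ler_normD _ _) _.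
  by rewrite lerD ?b1 ?b2.
by apply: cvgD; [exact: c1|exact: c2].
Qed.

Lemma ld_continuousM h1 h2 : ld_continuous h1 -> ld_continuous h2 ->
  ld_continuous (fun t => h1 t * h2 t).
Proof.
move=> [[M1 b1] c1] [[M2 b2] c2]; split=> [|t Kt rt].
  exists (M1 * M2) => t Kt; rewrite normrM ler_pM ?b1 ?b2 //.
by apply: cvgM; [exact: c1|exact: c2].
Qed.

Lemma ld_continuousZ c h : ld_continuous h -> ld_continuous (fun t => c * h t).
Proof. exact/ld_continuousM/ld_continuous_cst. Qed.

Lemma ld_continuousB h1 h2 : ld_continuous h1 -> ld_continuous h2 ->
  ld_continuous (fun t => h1 t - h2 t).
Proof.
move=> l1 l2; have := ld_continuousD l1 (ld_continuousZ (-1) l2).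
by under [X in ld_continuous X -> _]funext => t do rewrite mulN1r.
Qed.

(** * The fundamental lemma and the du Bois-Reymond lemma *)

Lemma antiderivative_continuous h H : nabla_antiderivative T a b h H ->
  forall t, X t -> H @ within X (nbhs t) --> H t.
Proof. by move=> A; apply: nabla_derivable_continuous => t Kt; exists (h t); exact: A. Qed.

Lemma ld_continuous_itv (h : R -> R) : (forall t, X t -> h @ within X (nbhs t) --> h t) ->
  ld_continuous h.
Proof.
move=> ch; apply: ld_continuous_kappa => t Kt.
by apply: cvg_within_subset (ch t (kappa_sub Kt)) => s /kappa_sub.
Qed.

Lemma antiderivative_shift c h H : nabla_antiderivative T a b h H ->
  nabla_antiderivative T a b h (fun t => H t + c).
Proof.
move=> A t Kt; rewrite -[h t]addr0; apply: is_nablaD => //; first exact: A.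
exact: is_nabla_cst.
Qed.

(* Testing against H itself gives int nu psi^2 = 0, with nu the backward
   graininess, so H is constant across the left gaps and H = H o rho.  Testing
   against an antiderivative of H then gives int H^2 = 0. *)
Lemma fundamental_lemma psi : ld_continuous psi ->
  (forall phi : R -> R, (forall t, X t -> phi @ within X (nbhs t) --> phi t) ->
    nabla_int T a b (fun t => psi t * phi t) a b = 0) ->
  forall t, K t -> psi t = 0.
Proof.
move=> lpsi test.
have Xa := ts_itv_left; have Xb := ts_itv_right.
have [H0 A0] := ld_integrable lpsi.
pose H t := H0 t + - H0 a.
have A : nabla_antiderivative T a b psi H by exact: antiderivative_shift.
have Ha : H a = 0 by rewrite /H subrr.
have Hb : H b = 0.
  have /(_ _)/wrap[] := test (fun=> 1); first by move=> t _; exact: cvg_cst.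
  rewrite (@nabla_intE _ H) ?Ha ?subr0//.
  by apply: (eq_antiderivative _ A) => t _; rewrite mulr1.
have cH := antiderivative_continuous A.
have lH := ld_continuous_itv cH.
have testP (phi : R -> R) P : (forall t, X t -> phi @ within X (nbhs t) --> phi t) ->
    nabla_antiderivative T a b (fun t => psi t * phi t) P -> P b = P a.
  by move=> cphi AP; apply/eqP; rewrite -subr_eq0 -(nabla_intE AP)// test.
have [P AP] := ld_integrable (ld_continuousM lpsi lH).
(* The derivative of [H * H] is [psi * H^rho + H * psi], so twice [psi * H] exceeds it by
   [psi * (H - H^rho)], and [H - H^rho = (t - rho t) * psi]. *)
have AW : nabla_antiderivative T a b (fun t => (t - rho t) * psi t ^+ 2)
    (fun t => 2 * P t + -1 * (H t * H t)).
  move=> t Kt.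
  have -> : (t - rho t) * psi t ^+ 2 =
      2 * (psi t * H t) + -1 * (psi t * H (rho t) + H t * psi t).
    have := is_nabla_jump Kt (A t Kt) => E.
    by rewrite expr2 mulrCA [(t - rho t) * psi t]mulrC -E; ring.
  apply: is_nablaD => //; apply: is_nablaZ => //; first exact: AP.
  by apply: is_nablaM => //; exact: A.
have jump t : K t -> H (rho t) = H t.
  move=> Kt; have := antiderivative_ge0_eq0 AW _ _ Kt.
  rewrite Ha Hb (testP H P)// => /(_ _ erefl) h.
  have /eqP : (t - rho t) * psi t ^+ 2 = 0.
    by apply: h => u Ku; rewrite mulr_ge0 ?sqr_ge0// subr_ge0 (rho_le (kappa_sub Ku)).
  rewrite mulf_eq0 sqrf_eq0 => h'.
  have E := is_nabla_jump Kt (A t Kt); apply/eqP; rewrite eq_sym -subr_eq0 E.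
  by rewrite mulf_eq0 orbC.
have [Phi APhi] := ld_integrable lH.
have cPhi := antiderivative_continuous APhi.
have [Q AQ] := ld_integrable (ld_continuousM lpsi (ld_continuous_itv cPhi)).
(* Integration by parts for [Phi * H], whose derivative is [H * H^rho + Phi * psi]; [H^rho = H]
   turns the first term into a square. *)
have AV : nabla_antiderivative T a b (fun t => H t ^+ 2)
    (fun t => Phi t * H t + -1 * Q t).
  move=> t Kt.
  have -> : H t ^+ 2 = (H t * H (rho t) + Phi t * psi t) + -1 * (psi t * Phi t).
    by rewrite jump//; ring.
  apply: is_nablaD => //; last by apply: is_nablaZ => //; exact: AQ.
  by apply: is_nablaM => //; [exact: APhi|exact: A].
have H0K t : K t -> H t = 0.
  move=> Kt; have := antiderivative_ge0_eq0 AV _ _ Kt.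
  rewrite Ha Hb (testP Phi Q)// !mulr0 => /(_ _ erefl) h.
  by apply/eqP; rewrite -sqrf_eq0; apply/eqP/h => u _; exact: sqr_ge0.
have H0X t : X t -> H t = 0.
  move=> Xt; have [->//|ta] := eqVneq t a; apply/H0K/kappa_gt => //.
  by rewrite lt_neqAle eq_sym ta (ts_itv_ge Xt).
move=> t Kt; apply: (is_nabla_unique Kt (A t Kt)).
apply/is_nabla_ballP => e e0; exists 1 => // s Xs _.
rewrite (H0X s)// (H0X (rho t)); last exact/rho_mem/kappa_sub.
by rewrite mul0r !subrr normr0 mulr_ge0// ltW.
Qed.

Lemma C1_antiderivative (h H : R -> R) : nabla_antiderivative T a b h H ->
  (forall t, K t -> h @ within K (nbhs t) --> h t) -> C1 T a b H.
Proof.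
move=> A ch; have E t : K t -> nabla T a b H t = h t.
  by move=> Kt; apply: nablaE => //; exact: A.
split=> [t Kt|]; first by exists (h t); exact: A.
apply/subspace_continuousP => t Kt; apply/cvg_within_ballP => e e0.
have [d d0 Hd] := (cvg_within_ballP _ _ _ _).1 (ch t Kt) e e0.
exists d => // s Ks ts; have := Hd s Ks ts.
by rewrite -(E t Kt) -(E s Ks).
Qed.

Lemma C1_continuous h : C1 T a b h -> forall t, X t -> h @ within X (nbhs t) --> h t.
Proof. by case=> dh _; exact: nabla_derivable_continuous. Qed.

Lemma C1_nabla h : C1 T a b h -> nabla_antiderivative T a b (nabla T a b h) h.
Proof. by case=> dh _ t Kt; apply: nablaP; exact: dh. Qed.

Lemma C1_ld_nabla h : C1 T a b h -> ld_continuous (nabla T a b h).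
Proof. by case=> _ /subspace_continuousP; exact: ld_continuous_kappa. Qed.

Lemma C1_ld_rho h : C1 T a b h -> ld_continuous (fun t => h (rho t)).
Proof. by move=> /C1_continuous; exact: ld_continuous_rho. Qed.

Lemma C1_lin h1 h2 c : C1 T a b h1 -> C1 T a b h2 ->
  C1 T a b (fun t => h1 t + c * h2 t).
Proof.
move=> C1h C2h.
apply: (C1_antiderivative (antiderivativeD (C1_nabla C1h) (antiderivativeZ c (C1_nabla C2h)))).
move=> t Kt; apply: cvgD; first by case: C1h => _ /subspace_continuousP; exact.
by apply: cvgM; [exact: cvg_cst|case: C2h => _ /subspace_continuousP; exact].
Qed.

Lemma nabla_lin h1 h2 c t : C1 T a b h1 -> C1 T a b h2 -> K t ->
  nabla T a b (fun t => h1 t + c * h2 t) t = nabla T a b h1 t + c * nabla T a b h2 t.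
Proof.
move=> C1h C2h Kt; apply: nablaE => //.
exact: (antiderivativeD (C1_nabla C1h) (antiderivativeZ c (C1_nabla C2h))).
Qed.

(** With [c] the mean value of [q - Q], the fundamental lemma applies to [q - Q - c]. For a
    continuous [phi], its primitive minus an affine function vanishes at both ends and has the
    continuous derivative [phi - m], so it is an allowed [eta]. *)
Lemma du_bois_reymond p q Q : ld_continuous p -> ld_continuous q ->
  (forall eta, C1 T a b eta -> eta a = 0 -> eta b = 0 ->
    nabla_int T a b (fun t => p t * eta (rho t) + q t * nabla T a b eta t) a b = 0) ->
  nabla_antiderivative T a b p Q ->
  exists c, forall t, K t -> q t - Q t = c.
Proof.
move=> lp lq stat AQ.
have Xa := ts_itv_left; have Xb := ts_itv_right.
have lpsi := ld_continuousB lq (ld_continuous_itv (antiderivative_continuous AQ)).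
have [Psi APsi] := ld_integrable lpsi.
have ba : b - a != 0 by rewrite subr_eq0 gt_eqF.
pose c := (Psi b - Psi a) / (b - a).
have cE : c * (b - a) = Psi b - Psi a by rewrite /c divfK.
exists c => t Kt; apply/eqP; rewrite -subr_eq0; apply/eqP.
apply: (fundamental_lemma (ld_continuousB lpsi (ld_continuous_cst c)) _ Kt).
move=> phi cphi; have [Phi APhi] := ld_integrable (ld_continuous_itv cphi).
pose m := (Phi b - Phi a) / (b - a).
have mE : m * (b - a) = Phi b - Phi a by rewrite /m divfK.
pose eta u := Phi u + -1 * (m * u) + (m * a - Phi a).
have Aeta : nabla_antiderivative T a b (fun u => phi u + -1 * m) eta.
  by apply/antiderivative_shift/antiderivativeD => //; exact/antiderivativeZ/antiderivative_cst.
have Ceta : C1 T a b eta.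
  apply: (C1_antiderivative Aeta) => u Ku; apply: cvgD; last exact: cvg_cst.
  by apply: cvg_within_subset (cphi u (kappa_sub Ku)) => s /kappa_sub.
have ea : eta a = 0 by rewrite /eta; ring.
have eb : eta b = 0.
  have -> : eta b = Phi b - Phi a - m * (b - a) by rewrite /eta; ring.
  by rewrite mE subrr.
have lG := ld_continuousD (ld_continuousM lp (C1_ld_rho Ceta))
  (ld_continuousM lq (C1_ld_nabla Ceta)).
have [G AG] := ld_integrable lG.
have := stat eta Ceta ea eb; rewrite (nabla_intE AG)// => Gba.
(* [G - Q * eta] is a primitive of [(q - Q) * (phi - m)] by the product rule; the rest contributes
   [m * c * (b - a) - c * m * (b - a) = 0]. *)
have AW : nabla_antiderivative T a b (fun u => (q u - Q u - c) * phi u)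
    (fun u => (G u + -1 * (Q u * eta u)) + (m * Psi u + -1 * (c * Phi u))).
  move=> u Ku.
  have -> : (q u - Q u - c) * phi u =
      (p u * eta (rho u) + q u * nabla T a b eta u
       + -1 * (p u * eta (rho u) + Q u * (phi u + -1 * m)))
      + (m * (q u - Q u) + -1 * (c * phi u)).
    by rewrite (nablaE Ku (Aeta u Ku)); ring.
  apply: is_nablaD => //; apply: is_nablaD => //; try apply: is_nablaZ => //.
  - exact: AG.
  - by apply: is_nablaM => //; [exact: AQ|exact: Aeta].
  - exact: APsi.
  - by apply: is_nablaZ => //; exact: APhi.
rewrite (nabla_intE AW)// ea eb.
have -> : G b = G a by apply/eqP; rewrite -subr_eq0 Gba.
have -> : Psi b = Psi a + c * (b - a) by rewrite cE; ring.
have -> : Phi b = Phi a + m * (b - a) by rewrite mE; ring.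
by ring.
Qed.

(** * Estimates for the Lagrangian, uniform in [t] *)

Lemma is_derive_partial_x L (t x v : R) : C1_lagrangian T a b L -> X t ->
  is_derive x 1 (fun u => L t u v) (partial_x L t x v).
Proof.
by move=> [dx _ _ _] Xt; rewrite /partial_x derive1E; apply/derivableP/dx.
Qed.

Lemma is_derive_partial_v L (t x v : R) : C1_lagrangian T a b L -> X t ->
  is_derive v 1 (L t x) (partial_v L t x v).
Proof.
by move=> [_ dv _ _] Xt; rewrite /partial_v derive1E; apply/derivableP/dv.
Qed.

Section Estimates.
Variable M : R.

Lemma box_continuous (G : R -> R -> R -> R) :
  {within [set p : R * R * R | X p.1.1],
    continuous (fun p : R * R * R => G p.1.1 p.1.2 p.2)} ->
  (exists C : R, forall t x v : R, X t -> `|x| <= M -> `|v| <= M -> `|G t x v| <= C) /\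
  forall e : R, 0 < e -> exists2 d : R, 0 < d & forall t t' x x' v v' : R, X t -> X t' ->
    `|x| <= M -> `|x'| <= M -> `|v| <= M -> `|v'| <= M ->
    `|t - t'| < d -> `|x - x'| < d -> `|v - v'| < d ->
    `|G t x v - G t' x' v'| <= e.
Proof.
move=> cG; pose B : set (R * R * R) := (X `*` `[- M, M]) `*` `[- M, M].
have cB : compact B.
  apply: compact_setX; [apply: compact_setX|]; [exact: ts_itv_compact| |];
  exact: segment_compact.
have inB t x v : X t -> `|x| <= M -> `|v| <= M -> B (t, x, v).
  by move=> Xt; rewrite !ler_norml => xM vM; split; [split=> //|]; rewrite /= in_itv.
have {}cG : {within B, continuous (fun p : R * R * R => G p.1.1 p.1.2 p.2)}.
  by apply: continuous_subspaceW cG => p [[]].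
split.
  have [C HC] := continuous_within_bounded cB cG.
  by exists C => t x v Xt xM vM; apply: (HC (t, x, v)); exact: inB.
move=> e e0; have [d d0 Hd] := compact_unif_continuous cB cG e0.
exists d => // t t' x x' v v' Xt Xt' xM xM' vM vM' tt' xx' vv'.
by apply: (Hd (t, x, v) (t', x', v')); [exact: inB|exact: inB|].
Qed.

Lemma lagrangian_lipschitz L : C1_lagrangian T a b L ->
  exists2 C : R, 0 <= C & forall t x v x' v' : R, X t ->
    `|x| <= M -> `|v| <= M -> `|x'| <= M -> `|v'| <= M ->
    `|L t x' v' - L t x v| <= C * (`|x' - x| + `|v' - v|).
Proof.
move=> hL; have [_ _ /box_continuous[[C1 b1] _] /box_continuous[[C2 b2] _]] := hL.
exists (Num.max 0 (Num.max C1 C2)); first by rewrite le_max lexx.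
have m1 : C1 <= Num.max 0 (Num.max C1 C2) by rewrite !le_max lexx orbT.
have m2 : C2 <= Num.max 0 (Num.max C1 C2) by rewrite !le_max lexx !orbT.
move=> t x v x' v' Xt xM vM xM' vM'.
have := @mvt2_norm_le _ (L t) (partial_x L t) (partial_v L t) 0 0 M _ x v x' v'.
rewrite !subr0; apply=> // u w.
- exact: is_derive_partial_x.
- exact: is_derive_partial_v.
rewrite !subr0 => uM wM; split.
  exact: le_trans (b1 _ _ _ Xt uM wM) m1.
exact: le_trans (b2 _ _ _ Xt uM wM) m2.
Qed.

(** The mean value estimate is applied to [L t - L t'], whose partial derivatives are small by
    uniform continuity; continuity of [L] in [t] is never invoked. *)
Lemma lagrangian_increment_continuous L : C1_lagrangian T a b L ->
  forall e : R, 0 < e -> exists2 d : R, 0 < d & forall t t' x v x' v' : R, X t -> X t' ->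
    `|x| <= M -> `|v| <= M -> `|x'| <= M -> `|v'| <= M -> `|t - t'| < d ->
    `|(L t x' v' - L t x v) - (L t' x' v' - L t' x v)|
      <= e * (`|x' - x| + `|v' - v|).
Proof.
move=> hL e e0; have [_ _ /box_continuous[_ c1] /box_continuous[_ c2]] := hL.
have [d1 d10 H1] := c1 e e0; have [d2 d20 H2] := c2 e e0.
exists (Num.min d1 d2); first by rewrite lt_min d10.
move=> t t' x v x' v' Xt Xt' xM vM xM' vM'; rewrite lt_min => /andP[t1 t2].
have -> : L t x' v' - L t x v - (L t' x' v' - L t' x v) =
  (L t x' v' - L t' x' v') - (L t x v - L t' x v) by ring.
have := @mvt2_norm_le _ (fun u w => L t u w - L t' u w)
  (fun u w => partial_x L t u w - partial_x L t' u w)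
  (fun u w => partial_v L t u w - partial_v L t' u w) 0 0 M e x v x' v'.
rewrite !subr0; apply=> // u w.
- by apply: is_deriveB; exact: is_derive_partial_x.
- by apply: is_deriveB; exact: is_derive_partial_v.
by rewrite !subr0 => uM wM; split; [apply: H1|apply: H2]; rewrite ?subrr ?normr0.
Qed.

End Estimates.

Lemma lagrangian_taylor (M : R) L : C1_lagrangian T a b L ->
  forall e : R, 0 < e -> exists2 d : R, 0 < d & forall t x v p q : R, X t ->
    `|x| <= M -> `|v| <= M -> `|p| <= d -> `|q| <= d ->
    `|L t (x + p) (v + q) - L t x v - (partial_x L t x v * p + partial_v L t x v * q)|
      <= e * (`|p| + `|q|).
Proof.
move=> hL e e0.
have [_ _ /(box_continuous (M + 1))[_ c1] /(box_continuous (M + 1))[_ c2]] := hL.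
have [d1 d10 H1] := c1 e e0; have [d2 d20 H2] := c2 e e0.
(* The bound 1 keeps the perturbed point in the box of radius [M + 1]; the halves turn [<= d] into
   the strict inequalities required by uniform continuity. *)
pose d := Num.min (Num.min (d1 / 2) (d2 / 2)) 1.
have d0 : 0 < d by rewrite !lt_min ltr01 !divr_gt0.
have dd1 : d < d1 by apply: (@le_lt_trans _ _ (d1 / 2)); [rewrite !ge_min lexx|lra].
have dd2 : d < d2 by apply: (@le_lt_trans _ _ (d2 / 2)); [rewrite !ge_min lexx !orbT|lra].
have d11 : d <= 1 by rewrite ge_min lexx orbT.
exists d => // t x v p q Xt xM vM pd qd.
set Lx := partial_x L t x v; set Lv := partial_v L t x v.
have -> : L t (x + p) (v + q) - L t x v - (Lx * p + Lv * q) =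
  (L t (x + p) (v + q) - (Lx * (x + p) + Lv * (v + q)))
  - (L t x v - (Lx * x + Lv * v)) by ring.
have Ep : p = x + p - x by ring.
have Eq : q = v + q - v by ring.
rewrite [in leRHS]Ep [in leRHS]Eq.
apply: (@mvt2_norm_le _ (fun u w => L t u w - (Lx * u + Lv * w))
  (fun u w => partial_x L t u w - Lx) (fun u w => partial_v L t u w - Lv) x v d
  e x v (x + p) (v + q)); rewrite -?Ep -?Eq ?subrr ?normr0 ?(ltW d0)//.
- move=> u w; apply: is_deriveB; first exact: is_derive_partial_x.
  exact: is_derive_affine.
- move=> u w; apply: is_deriveB; first exact: is_derive_partial_v.
  by under eq_fun do rewrite addrC; exact: is_derive_affine.
move=> u w ux wv.
have uM : `|u| <= M + 1.
  by rewrite -[u](subrK x); apply: le_trans (ler_normD _ _) _; lra.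
have wM : `|w| <= M + 1.
  by rewrite -[w](subrK v); apply: le_trans (ler_normD _ _) _; lra.
have xM1 : `|x| <= M + 1 by apply: le_trans xM _; rewrite lerDl.
have vM1 : `|v| <= M + 1 by apply: le_trans vM _; rewrite lerDl.
split; [apply: H1|apply: H2]; rewrite ?subrr ?normr0//.
- exact: le_lt_trans ux dd1.
- exact: le_lt_trans wv dd1.
- exact: le_lt_trans ux dd2.
- exact: le_lt_trans wv dd2.
Qed.

(** * Integrability along C1 functions and the first variation *)

Lemma ld_continuous_bounded (h : R -> R) : ld_continuous h ->
  exists2 M : R, 0 <= M & forall t, K t -> `|h t| <= M.
Proof.
move=> [[M HM] _]; exists M => //; apply: le_trans (HM b kappa_right); exact: normr_ge0.
Qed.

Lemma ld_continuous_ballP (h : R -> R) t : ld_continuous h -> K t -> rho t = t ->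
  forall e : R, 0 < e -> exists2 d : R, 0 < d &
    forall s, K s -> `|t - s| < d -> `|h t - h s| <= e.
Proof. by move=> [_ ch] Kt rt; apply/cvg_within_ballP/ch. Qed.

Lemma ld_continuous_comp (G : R -> R -> R -> R) (x v : R -> R) :
  {within [set p : R * R * R | X p.1.1],
    continuous (fun p : R * R * R => G p.1.1 p.1.2 p.2)} ->
  ld_continuous x -> ld_continuous v -> ld_continuous (fun t => G t (x t) (v t)).
Proof.
move=> cG lx lv.
have [M1 M10 xM] := ld_continuous_bounded lx.
have [M2 M20 vM] := ld_continuous_bounded lv.
have {}xM t : K t -> `|x t| <= M1 + M2 by move=> /xM; lra.
have {}vM t : K t -> `|v t| <= M1 + M2 by move=> /vM; lra.
have [[C HC] HG] := box_continuous (M1 + M2) cG.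
split=> [|t Kt rt].
  by exists C => t Kt; apply: HC; [exact: kappa_sub|exact: xM|exact: vM].
apply/cvg_within_ballP => e e0; have [d d0 Hd] := HG e e0.
have d20 : 0 < d / 2 by lra.
have [d1 d10 H1] := ld_continuous_ballP lx Kt rt d20.
have [d2 d20' H2] := ld_continuous_ballP lv Kt rt d20.
exists (Num.min d (Num.min d1 d2)); first by rewrite !lt_min d0 d10.
move=> s Ks; rewrite !lt_min => /and3P[ts /(H1 s Ks) h1 /(H2 s Ks) h2].
apply: Hd => //; try exact: kappa_sub; try exact: xM; try exact: vM; lra.
Qed.

Lemma ld_continuous_increment L (x v x' v' : R -> R) : C1_lagrangian T a b L ->
  ld_continuous x -> ld_continuous v -> ld_continuous x' -> ld_continuous v' ->
  ld_continuous (fun t => L t (x' t) (v' t) - L t (x t) (v t)).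
Proof.
move=> hL lx lv lx' lv'.
have [M1 M10 xM] := ld_continuous_bounded lx.
have [M2 M20 vM] := ld_continuous_bounded lv.
have [M3 M30 xM'] := ld_continuous_bounded lx'.
have [M4 M40 vM'] := ld_continuous_bounded lv'.
pose M := M1 + M2 + M3 + M4.
have {}xM t : K t -> `|x t| <= M by move=> /xM; rewrite /M; lra.
have {}vM t : K t -> `|v t| <= M by move=> /vM; rewrite /M; lra.
have {}xM' t : K t -> `|x' t| <= M by move=> /xM'; rewrite /M; lra.
have {}vM' t : K t -> `|v' t| <= M by move=> /vM'; rewrite /M; lra.
have M0 : 0 <= M by rewrite /M; lra.
have inc t : K t -> `|x' t - x t| + `|v' t - v t| <= 4 * M.
  move=> Kt; have := ler_normB (x' t) (x t); have := ler_normB (v' t) (v t).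
  by move: (xM t Kt) (vM t Kt) (xM' t Kt) (vM' t Kt); lra.
have [C C0 HC] := lagrangian_lipschitz M hL.
split=> [|t Kt rt].
  exists (C * (4 * M)) => t Kt.
  apply: le_trans (ler_wpM2l C0 (inc t Kt)).
  by apply: HC; [exact: kappa_sub|exact: xM|exact: vM|exact: xM'|exact: vM'].
apply/cvg_within_ballP => e e0.
(* The error budget: increments have size at most [4 * M], so changing [t] costs at most [e / 2];
   with [n] below, moving each pair of arguments costs [C * (2 * n) <= e / 4]. *)
have q0 : 0 < e / (8 * M + 1) by rewrite divr_gt0//; lra.
have qE : e / (8 * M + 1) * (4 * M) <= e / 2.
  have -> : e / (8 * M + 1) * (4 * M) = (e / 2) * (8 * M / (8 * M + 1)).
    by field; rewrite lt0r_neq0//; lra.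
  have r1 : 8 * M / (8 * M + 1) <= 1 by rewrite ler_pdivrMr ?mul1r ?lerDl//; lra.
  by rewrite -[leRHS]mulr1 ler_wpM2l// divr_ge0// ltW.
have [d d0 Hd] := lagrangian_increment_continuous M hL q0.
pose n := e / (8 * (C + 1)).
have n0 : 0 < n by rewrite divr_gt0//; lra.
have nE : 8 * (C + 1) * n = e by rewrite /n mulrC divfK// lt0r_neq0//; lra.
have Cn : C * (2 * n) * 4 <= e by rewrite -nE; have := mulr_ge0 C0 (ltW n0); lra.
have [d1 d10 H1] := ld_continuous_ballP lx Kt rt n0.
have [d2 d20 H2] := ld_continuous_ballP lv Kt rt n0.
have [d3 d30 H3] := ld_continuous_ballP lx' Kt rt n0.
have [d4 d40 H4] := ld_continuous_ballP lv' Kt rt n0.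
exists (Num.min d (Num.min d1 (Num.min d2 (Num.min d3 d4)))).
  by rewrite !lt_min d0 d10 d20 d30.
move=> s Ks; rewrite !lt_min => /and5P[ts /(H1 s Ks) h1 /(H2 s Ks) h2 /(H3 s Ks) h3 /(H4 s Ks) h4].
have Xt := kappa_sub Kt; have Xs := kappa_sub Ks.
have k1 := HC s _ _ _ _ Xs (xM s Ks) (vM s Ks) (xM t Kt) (vM t Kt).
have k2 := HC s _ _ _ _ Xs (xM' s Ks) (vM' s Ks) (xM' t Kt) (vM' t Kt).
have k3 := Hd t s _ _ _ _ Xt Xs (xM t Kt) (vM t Kt) (xM' t Kt) (vM' t Kt) ts.
have {}k1 : `|L s (x t) (v t) - L s (x s) (v s)| <= C * (2 * n).
  by apply: le_trans k1 _; rewrite ler_wpM2l//; lra.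
have {}k2 : `|L s (x' t) (v' t) - L s (x' s) (v' s)| <= C * (2 * n).
  by apply: le_trans k2 _; rewrite ler_wpM2l//; lra.
have {}k3 := le_trans k3 (ler_wpM2l (ltW q0) (inc t Kt)).
(* First [t] becomes [s] in the slot of [L] with the arguments frozen at time [t], then the
   arguments move with [L s] fixed. *)
rewrite -[X in `|X|](_ : (L t (x' t) (v' t) - L t (x t) (v t)
    - (L s (x' t) (v' t) - L s (x t) (v t)))
  + (L s (x' t) (v' t) - L s (x' s) (v' s))
  - (L s (x t) (v t) - L s (x s) (v s)) = _); last by ring.
apply: le_trans (ler_normB _ _) _.
have := ler_normD (L t (x' t) (v' t) - L t (x t) (v t)
    - (L s (x' t) (v' t) - L s (x t) (v t))) (L s (x' t) (v' t) - L s (x' s) (v' s)).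
lra.
Qed.

Lemma along_integrable L y z : C1_lagrangian T a b L -> C1 T a b y -> C1 T a b z ->
  nabla_integrable T a b (along T a b L y) -> nabla_integrable T a b (along T a b L z).
Proof.
move=> hL hy hz [H A].
have [H' A'] := ld_integrable (ld_continuous_increment hL (C1_ld_rho hy)
  (C1_ld_nabla hy) (C1_ld_rho hz) (C1_ld_nabla hz)).
exists (fun t => H t + H' t); apply: eq_antiderivative (antiderivativeD A A') => t _.
by rewrite /along; ring.
Qed.

Definition variation L y eta t :=
  along T a b (partial_x L) y t * eta (rho t) +
  along T a b (partial_v L) y t * nabla T a b eta t.

Definition first_variation L y eta := nabla_int T a b (variation L y eta) a b.

Lemma ld_continuous_along_x L y : C1_lagrangian T a b L -> C1 T a b y ->
  ld_continuous (along T a b (partial_x L) y).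
Proof.
by move=> [_ _ cx _] hy; exact: (ld_continuous_comp cx (C1_ld_rho hy) (C1_ld_nabla hy)).
Qed.

Lemma ld_continuous_along_v L y : C1_lagrangian T a b L -> C1 T a b y ->
  ld_continuous (along T a b (partial_v L) y).
Proof.
by move=> [_ _ _ cv] hy; exact: (ld_continuous_comp cv (C1_ld_rho hy) (C1_ld_nabla hy)).
Qed.

Lemma variation_integrable L y eta : C1_lagrangian T a b L -> C1 T a b y ->
  C1 T a b eta -> nabla_integrable T a b (variation L y eta).
Proof.
move=> hL hy he; apply: ld_integrable; apply: ld_continuousD; apply: ld_continuousM.
- exact: ld_continuous_along_x.
- exact: C1_ld_rho.
- exact: ld_continuous_along_v.
- exact: C1_ld_nabla.
Qed.

Lemma first_variation_lin L y h1 h2 c : C1_lagrangian T a b L -> C1 T a b y ->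
  C1 T a b h1 -> C1 T a b h2 ->
  first_variation L y (fun t => h1 t + c * h2 t) =
  first_variation L y h1 + c * first_variation L y h2.
Proof.
move=> hL hy c1 c2; have Xa := ts_itv_left; have Xb := ts_itv_right.
have [H1 A1] := variation_integrable hL hy c1.
have [H2 A2] := variation_integrable hL hy c2.
have A : nabla_antiderivative T a b (variation L y (fun t => h1 t + c * h2 t))
    (fun t => H1 t + c * H2 t).
  apply: eq_antiderivative (antiderivativeD A1 (antiderivativeZ c A2)) => t Kt.
  by rewrite /variation nabla_lin//; ring.
by rewrite /first_variation (nabla_intE A1)// (nabla_intE A2)// (nabla_intE A)//; ring.
Qed.

(** * First-order expansion of the functional and constrained perturbation *)

Lemma functional_taylor L y : C1_lagrangian T a b L -> C1 T a b y ->
  nabla_integrable T a b (along T a b L y) ->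
  forall e : R, 0 < e -> exists2 d : R, 0 < d & forall z m, C1 T a b z -> m <= d ->
    (forall t, K t -> `|z (rho t) - y (rho t)| <= m) ->
    (forall t, K t -> `|nabla T a b z t - nabla T a b y t| <= m) ->
    `|functional T a b L z - functional T a b L y
      - (first_variation L y z - first_variation L y y)| <= e * m.
Proof.
move=> hL hy iy e e0; have Xa := ts_itv_left; have Xb := ts_itv_right.
have [M1 M10 yM] := ld_continuous_bounded (C1_ld_rho hy).
have [M2 M20 dM] := ld_continuous_bounded (C1_ld_nabla hy).
have ba : 0 < b - a by rewrite subr_gt0.
(* Both arguments move by at most [m], so the pointwise error is [e / (b - a) * m], which integrates
   to [e * m]. *)
have q0 : 0 < e / (2 * (b - a)) by rewrite divr_gt0//; lra.
have [d d0 Hd] := lagrangian_taylor (M1 + M2) hL q0.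
exists d => // z m hz md zm dzm.
have [Hy Ay] := iy; have [Hz Az] := along_integrable hL hy hz iy.
have [Vy By] := variation_integrable hL hy hy.
have [Vz Bz] := variation_integrable hL hy hz.
have A := antiderivativeD (antiderivativeD Az (antiderivativeZ (-1) Ay))
  (antiderivativeZ (-1) (antiderivativeD Bz (antiderivativeZ (-1) By))).
have bound t : K t -> `|along T a b L z t + -1 * along T a b L y t
    + -1 * (variation L y z t + -1 * variation L y y t)| <= e / (b - a) * m.
  move=> Kt; have Xt := kappa_sub Kt.
  have h1 := zm t Kt; have h2 := dzm t Kt.
  have k1 : `|y (rho t)| <= M1 + M2 by have := yM t Kt; lra.
  have k2 : `|nabla T a b y t| <= M1 + M2 by have := dM t Kt; lra.
  have := Hd t _ _ _ _ Xt k1 k2 (le_trans h1 md) (le_trans h2 md).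
  set p := z (rho t) - y (rho t) in h1 *; set q := nabla T a b z t - nabla T a b y t in h2 *.
  rewrite /along /variation /along.
  have -> : y (rho t) + p = z (rho t) by rewrite /p; ring.
  have -> : nabla T a b y t + q = nabla T a b z t by rewrite /q; ring.
  move=> h; have -> : e / (b - a) * m = e / (2 * (b - a)) * (m + m).
    by field; rewrite lt0r_neq0.
  have h3 := ler_wpM2l (ltW q0) (lerD h1 h2).
  apply: le_trans h3; apply: le_trans h; rewrite le_eqVlt; apply/orP; left.
  by apply/eqP; congr (`|_|); rewrite /p /q; ring.
have := antiderivative_norm_le A bound Xa Xb (ltW hab).
rewrite /functional /first_variation (nabla_intE Ay)// (nabla_intE Az)//.
rewrite (nabla_intE By)// (nabla_intE Bz)//.
have -> : e / (b - a) * m * (b - a) = e * m by field; rewrite lt0r_neq0.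
move=> h; apply: le_trans h; rewrite le_eqVlt; apply/orP; left.
by apply/eqP; congr (`|_|); ring.
Qed.

Lemma kappa_norm_le (h : R -> R) c : (forall t, K t -> `|h t| <= c) ->
  kappa_norm T a b h <= c.
Proof.
move=> hc; apply: ge_sup; first by exists `|h b|; exists b => //; exact: kappa_right.
by move=> _ [t Kt <-]; exact: hc.
Qed.

(** The expansion based at [y + s * eta], with error constant 1, gives a local Lipschitz bound in
    the line parameter. *)
Lemma functional_line_continuous L y eta : C1_lagrangian T a b L -> C1 T a b y ->
  C1 T a b eta -> nabla_integrable T a b (along T a b L y) ->
  continuous (fun s : R => functional T a b L (fun t => y t + s * eta t)).
Proof.
move=> hL hy he iy s.
have C1s u : C1 T a b (fun t => y t + u * eta t) by exact: C1_lin.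
have [N1 N10 eN] := ld_continuous_bounded (C1_ld_rho he).
have [N2 N20 dN] := ld_continuous_bounded (C1_ld_nabla he).
have [d d0 Hd] := functional_taylor hL (C1s s)
  (along_integrable hL hy (C1s s) iy) ltr01.
set D := first_variation L (fun t => y t + s * eta t) eta.
pose N := N1 + N2 + 1; have N0 : 0 < N by rewrite /N; lra.
have key u : `|s - u| * N <= d ->
    `|functional T a b L (fun t => y t + s * eta t)
      - functional T a b L (fun t => y t + u * eta t)| <= (N + `|D|) * `|s - u|.
  move=> ud; have := Hd _ _ (C1s u) ud; rewrite mul1r.
  rewrite !(first_variation_lin _ hL (C1s s) hy he) -/D => h.
  have {}h := h _ _; set I1 := functional _ _ _ _ _ in h *; set I2 := functional _ _ _ _ _ in h *.
  have -> : I2 - I1 = - (I1 - I2 - (u - s) * D) + (s - u) * D by ring.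
  have -> : (N + `|D|) * `|s - u| = `|s - u| * N + `|(s - u) * D| by rewrite normrM; ring.
  apply: le_trans (ler_normD _ _) _; rewrite normrN lerD2r.
  rewrite (_ : (u - s) * D = first_variation L (fun t => y t + s * eta t) y + u * D
    - (first_variation L (fun t => y t + s * eta t) y + s * D)); last by ring.
  apply: h => t Kt.
    have -> : y (rho t) + u * eta (rho t) - (y (rho t) + s * eta (rho t)) =
      - ((s - u) * eta (rho t)) by ring.
    by rewrite normrN normrM ler_wpM2l//; have := eN t Kt; rewrite /N; lra.
  rewrite !nabla_lin//.
  have -> : nabla T a b y t + u * nabla T a b eta t -
    (nabla T a b y t + s * nabla T a b eta t) = - ((s - u) * nabla T a b eta t) by ring.
  by rewrite normrN normrM ler_wpM2l//; have := dN t Kt; rewrite /N; lra.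
apply/cvgrPdist_le => e e0; apply/nbhs_ballP.
have ND : 0 < N + `|D| by rewrite ltr_pwDl.
exists (Num.min (d / N) (e / (N + `|D|))); first by rewrite /= lt_min !divr_gt0.
move=> u /=; rewrite /ball /= lt_min !ltr_pdivlMr// => /andP[h1 h2].
by apply: le_trans (key u (ltW h1)) _; rewrite mulrC ltW.
Qed.

(* Moving along eps eta + s eta0 with |s| at most a small multiple of eps, the
   constraint is restored by the intermediate value theorem in s, and the sign
   of the change of the functional is decided by eta. *)
Lemma constrained_perturbation f g y eta eta0 (delta : R) :
  C1_lagrangian T a b f -> C1_lagrangian T a b g -> C1 T a b y ->
  nabla_integrable T a b (along T a b f y) ->
  nabla_integrable T a b (along T a b g y) ->
  C1 T a b eta -> eta a = 0 -> eta b = 0 ->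
  C1 T a b eta0 -> eta0 a = 0 -> eta0 b = 0 ->
  first_variation g y eta0 != 0 -> first_variation g y eta = 0 ->
  first_variation f y eta != 0 -> 0 < delta ->
  exists z, [/\ admissible T a b (y a) (y b) (functional T a b g y) g z,
    nabla_integrable T a b (along T a b f z), C1_dist T a b z y < delta &
    0 < (functional T a b f z - functional T a b f y) * first_variation f y eta].
Proof.
move=> hf hg hy fy gy he ea eb he0 e0a e0b.
move=> B0 gE A0 delta0.
have [A [A' [B E]]] : exists A A' B, [/\ first_variation f y eta = A,
    first_variation f y eta0 = A', first_variation g y eta0 = B &
    first_variation g y eta = 0] by do 3 eexists.
clear gE; have AE : first_variation f y eta = A by case: E.
have BE : first_variation g y eta0 = B by case: E.
rewrite AE in A0 *; rewrite BE in B0; clear AE BE.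
have [N1 N10 bN1] := ld_continuous_bounded (C1_ld_rho he).
have [N2 N20 bN2] := ld_continuous_bounded (C1_ld_nabla he).
have [N3 N30 bN3] := ld_continuous_bounded (C1_ld_rho he0).
have [N4 N40 bN4] := ld_continuous_bounded (C1_ld_nabla he0).
have [N N0 [bN bN' b0N b0N']] : exists2 N, 0 < N &
   [/\ forall t, K t -> `|eta (rho t)| <= N,
       forall t, K t -> `|nabla T a b eta t| <= N,
       forall t, K t -> `|eta0 (rho t)| <= N &
       forall t, K t -> `|nabla T a b eta0 t| <= N].
  exists (N1 + N2 + N3 + N4 + 1); first lra.
  by split=> t Kt; [have := bN1 t Kt|have := bN2 t Kt|have := bN3 t Kt|have := bN4 t Kt]; lra.
clear N1 N10 bN1 N2 N20 bN2 N3 N30 bN3 N4 N40 bN4.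
have nA : 0 < `|A| by rewrite normr_gt0.
have nB : 0 < `|B| by rewrite normr_gt0.
(* Corrections with [|s| <= k * eps] then change I to first order by at most half of [eps * |A|]. *)
have [k k0 kA] : exists2 k, 0 < k & k * `|A'| <= `|A| / 2.
  have A'0 : 0 < `|A'| + 1 by rewrite ltr_pwDr.
  exists (`|A| / 2 / (`|A'| + 1)); first by rewrite !divr_gt0.
  by rewrite mulrAC ler_pdivrMr// ler_pM2l ?divr_gt0// lerDl.
have [m m0 mE] : exists2 m, 0 < m & m = (1 + k) * N.
  by exists ((1 + k) * N) => //; rewrite mulr_gt0// addr_gt0.
(* The perturbation has size at most [d = eps * m]. The remainder of I is then at most
   [eps * |A| / 4], so with the correction it stays below [eps * |A|]; that of J is at most half of
   [k * eps * |B|]. *)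
have qf : 0 < `|A| / (4 * m) by rewrite divr_gt0// mulr_gt0.
have qg : 0 < k * `|B| / (2 * m) by rewrite divr_gt0// mulr_gt0.
have [df df0 Tf] := functional_taylor hf hy fy qf.
have [dg dg0 Tg] := functional_taylor hg hy gy qg.
have [d d0 [ddf ddg ddelta]] : exists2 d, 0 < d & [/\ d <= df, d <= dg & d + d < delta].
  exists (Num.min (Num.min df dg) (delta / 3)); first by rewrite !lt_min df0 dg0 divr_gt0.
  split; rewrite ?ge_min ?lexx ?orbT//.
  have : Num.min (Num.min df dg) (delta / 3) <= delta / 3 by rewrite ge_min lexx orbT.
  lra.
have [eps eps0 epsm] : exists2 eps, 0 < eps & eps * m = d.
  by exists (d / m); [rewrite divr_gt0|rewrite divfK// lt0r_neq0].
pose ye t := y t + eps * eta t; have hye : C1 T a b ye by exact: C1_lin.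
pose z s t := ye t + s * eta0 t; have hz s : C1 T a b (z s) by exact: C1_lin.
have small s : `|s| <= k * eps ->
    (forall t, K t -> `|z s (rho t) - y (rho t)| <= d) /\
    (forall t, K t -> `|nabla T a b (z s) t - nabla T a b y t| <= d).
  move=> sk; have aux p q : `|p| <= N -> `|q| <= N -> `|eps * p + s * q| <= d.
    move=> pN qN; apply: le_trans (ler_normD _ _) _; rewrite !normrM (gtr0_norm eps0).
    have h1 : eps * `|p| <= eps * N by rewrite ler_pM2l.
    have h2 : `|s| * `|q| <= k * eps * N by rewrite ler_pM.
    by rewrite -epsm mE; lra.
  split=> t Kt.
    have -> : z s (rho t) - y (rho t) = eps * eta (rho t) + s * eta0 (rho t).
      by rewrite /z /ye; ring.
    by apply: aux; [exact: bN|exact: b0N].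
  rewrite /z nabla_lin// /ye nabla_lin//.
  set p := nabla _ _ _ eta t; set q := nabla _ _ _ eta0 t.
  rewrite [X in `|X|](_ : _ = eps * p + s * q); last by ring.
  by apply: aux; [exact: bN'|exact: b0N'].
have fvE L s : C1_lagrangian T a b L -> first_variation L y (z s) - first_variation L y y =
    eps * first_variation L y eta + s * first_variation L y eta0.
  by move=> hL; rewrite /z first_variation_lin// /ye first_variation_lin//; ring.
have G s : `|s| <= k * eps ->
    `|functional T a b g (z s) - functional T a b g y - s * B| <= eps * (k * `|B| / 2).
  move=> sk; have [z1 z2] := small s sk.
  have := Tg _ _ (hz s) ddg z1 z2; case: E => _ _ BE gE; rewrite fvE// gE mulr0 add0r BE.
  have -> // : k * `|B| / (2 * m) * d = eps * (k * `|B| / 2).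
  by rewrite -epsm; field; rewrite lt0r_neq0.
have ke0 : 0 < k * eps by rewrite mulr_gt0.
have [s sk gs] : exists2 s, `|s| <= k * eps & functional T a b g (z s) = functional T a b g y.
  have le : - (k * eps) <= k * eps by lra.
  have cG : {within `[- (k * eps), k * eps],
      continuous (fun s => functional T a b g (z s))}.
    apply: continuous_subspaceT; apply: functional_line_continuous => //.
    exact: along_integrable gy.
  have [|s sI gs] := IVT le cG (v := functional T a b g y); last first.
    by exists s => //; move: sI; rewrite in_itv /= ler_norml.
  (* At [s = k * eps] and [s = - (k * eps)] the term [s * B] dominates the remainder, so the two
     values of J lie on opposite sides of J[y]; the sign of [B] decides which is larger. *)
  have h1 := G (k * eps); have h2 := G (- (k * eps)).
  rewrite normrN in h2; rewrite (gtr0_norm ke0) in h1 h2.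
  move: (h1 (lexx _)) (h2 (lexx _)).
  have kB : 0 < eps * (k * `|B|) by rewrite !mulr_gt0.
  move: (functional T a b g (z (k * eps))) (functional T a b g (z (- (k * eps)))).
  move: (functional T a b g y); clear -kB B0 => r p q.
  rewrite !ler_norml ge_min le_max => /andP[h1a h1b] /andP[h2a h2b].
  move: B0; rewrite neq_lt => /orP[Bn|Bp].
    rewrite (ltr0_norm Bn) in h1a h1b h2a h2b kB.
    by apply/andP; split; apply/orP; [right|left]; lra.
  rewrite (gtr0_norm Bp) in h1a h1b h2a h2b kB.
  by apply/andP; split; apply/orP; [left|right]; lra.
have [z1 z2] := small s sk.
exists (z s); split.
- split=> //; first by rewrite /z /ye ea e0a !mulr0 !addr0.
    by rewrite /z /ye eb e0b !mulr0 !addr0.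
  exact: along_integrable gy.
- exact: along_integrable fy.
- by apply: le_lt_trans ddelta; apply: lerD; exact: kappa_norm_le.
have := Tf _ _ (hz s) ddf z1 z2; case: E => AE A'E _ _; rewrite fvE// AE A'E.
have -> : `|A| / (4 * m) * d = eps * (`|A| / 4).
  by rewrite -epsm; field; rewrite lt0r_neq0.
set I := _ - functional T a b f y => h1.
have h2 : `|s * A'| <= eps * (`|A| / 2).
  rewrite normrM; apply: le_trans (ler_wpM2r (normr_ge0 _) sk) _.
  by rewrite [k * _]mulrC -mulrA ler_pM2l.
clearbody I; clear -h1 h2 A0 eps0.
move: h1 h2; rewrite !ler_norml => /andP[h1a h1b] /andP[h2a h2b].
move: A0; rewrite neq_lt => /orP[An|Ap].
  rewrite (ltr0_norm An) in h1a h1b h2a h2b.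
  by have := nmulr_rlt0 eps An; rewrite eps0 => h; rewrite nmulr_lgt0//; lra.
rewrite (gtr0_norm Ap) in h1a h1b h2a h2b.
by have := mulr_gt0 eps0 Ap => h; rewrite pmulr_lgt0//; lra.
Qed.

(** * Stationarity, the multiplier and the Euler-Lagrange equation *)

Lemma stationary_not_extremal g y : C1_lagrangian T a b g -> C1 T a b y ->
  ~ extremal T a b g y ->
  exists eta, [/\ C1 T a b eta, eta a = 0, eta b = 0 & first_variation g y eta != 0].
Proof.
move=> hg hy nex; apply: contrapT => H; apply: nex; split=> //.
have lx := ld_continuous_along_x hg hy.
have [Q AQ] := ld_integrable lx.
have [|c hc] := du_bois_reymond lx (ld_continuous_along_v hg hy) _ AQ.
  move=> eta he ea eb; apply/eqP; apply: contrapT => /negP h.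
  by apply: H; exists eta.
(* The integral from [a] is [Q t - Q a], whence the shift of the constant. *)
exists (c + Q a) => t Kt; rewrite -(hc t Kt) (nabla_intE AQ ts_itv_left (kappa_sub Kt)).
by ring.
Qed.

Lemma local_extremum_stationary alpha beta Lambda f g y eta0 :
  C1_lagrangian T a b f -> C1_lagrangian T a b g ->
  local_minimum T a b alpha beta Lambda f g y \/
    local_maximum T a b alpha beta Lambda f g y ->
  C1 T a b eta0 -> eta0 a = 0 -> eta0 b = 0 -> first_variation g y eta0 != 0 ->
  forall eta, C1 T a b eta -> eta a = 0 -> eta b = 0 ->
    first_variation g y eta = 0 -> first_variation f y eta = 0.
Proof.
move=> hf hg hext he0 e0a e0b B0 eta he ea eb gE.
have [hy ya yb gy gL] : admissible T a b alpha beta Lambda g y.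
  by case: hext => -[].
have fy : nabla_integrable T a b (along T a b f y) by case: hext => -[].
apply/eqP; apply: contrapT => /negP A0.
(* [eta + -2 * eta] is [-eta] in the form to which the linearity lemmas apply. *)
have heN := C1_lin (-2) he he.
have gN : first_variation g y (fun t => eta t + -2 * eta t) = 0.
  by rewrite first_variation_lin// gE mulr0 addr0.
have fN : first_variation f y (fun t => eta t + -2 * eta t) =
    - first_variation f y eta by rewrite first_variation_lin//; ring.
have A0N : first_variation f y (fun t => eta t + -2 * eta t) != 0 by rewrite fN oppr_eq0.
have eaN : eta a + -2 * eta a = 0 by rewrite ea mulr0 addr0.
have ebN : eta b + -2 * eta b = 0 by rewrite eb mulr0 addr0.
have W eta' delta he' ea' eb' := @constrained_perturbation f g y eta' eta0 delta
  hf hg hy fy gy he' ea' eb' he0 e0a e0b B0.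
have {}W delta (delta0 : 0 < delta) := conj (W _ delta he ea eb gE A0 delta0)
  (W _ delta heN eaN ebN gN A0N delta0).
have pos (d r : R) : 0 <= d -> 0 < d * r -> 0 < r.
  by move=> d0; rewrite !ltNge; apply: contraNN => r0; rewrite mulr_ge0_le0.
case: hext => -[_ _ [delta /W[]]]; rewrite ya yb gL fN;
  move=> [z [az fz dz Iz]] [z' [az' fz' dz' Iz']] opt;
  have le := opt z az fz dz; have le' := opt z' az' fz' dz'.
  have := pos _ _ _ Iz'; rewrite subr_ge0 le' => /(_ isT).
  have := pos _ _ _ Iz; rewrite subr_ge0 le => /(_ isT).
  by rewrite oppr_gt0 => /ltW; rewrite leNgt => /negbTE ->.
have := pos (functional T a b f y - functional T a b f z') (first_variation f y eta).
rewrite -mulrNN opprB subr_ge0 le' => /(_ isT Iz').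
have := pos (functional T a b f y - functional T a b f z) (- first_variation f y eta).
rewrite -mulrNN opprB opprK subr_ge0 le => /(_ isT Iz).
by rewrite oppr_gt0 => /ltW; rewrite leNgt => /negbTE ->.
Qed.

Lemma euler_lagrange f g y lambda :
  C1_lagrangian T a b f -> C1_lagrangian T a b g -> C1 T a b y ->
  (forall eta, C1 T a b eta -> eta a = 0 -> eta b = 0 ->
    first_variation f y eta = lambda * first_variation g y eta) ->
  let F := fun t x v : R => f t x v - lambda * g t x v in
  exists2 Fv : R -> R,
    extends_from_kappa T a b (along T a b (partial_v F) y) Fv &
    nabla_antiderivative T a b (along T a b (partial_x F) y) Fv.
Proof.
move=> hf hg hy stat F.
have Fx t : K t -> along T a b (partial_x f) y t + (- lambda) * along T a b (partial_x g) y t =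
    along T a b (partial_x F) y t.
  move=> /kappa_sub Xt; rewrite /along; set x := y _; set v := nabla _ _ _ _ _.
  rewrite [RHS]/partial_x derive1E; apply/esym/derive_val; rewrite mulNr.
  apply: is_deriveB; first exact: is_derive_partial_x.
  by apply: is_deriveZ; exact: is_derive_partial_x.
have Fv t : K t -> along T a b (partial_v f) y t + (- lambda) * along T a b (partial_v g) y t =
    along T a b (partial_v F) y t.
  move=> /kappa_sub Xt; rewrite /along; set x := y _; set v := nabla _ _ _ _ _.
  rewrite [RHS]/partial_v derive1E; apply/esym/derive_val; rewrite mulNr.
  apply: is_deriveB; first exact: is_derive_partial_v.
  by apply: is_deriveZ; exact: is_derive_partial_v.
have lp := ld_continuousD (ld_continuous_along_x hf hy)
  (ld_continuousZ (- lambda) (ld_continuous_along_x hg hy)).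
have lq := ld_continuousD (ld_continuous_along_v hf hy)
  (ld_continuousZ (- lambda) (ld_continuous_along_v hg hy)).
have [Q AQ] := ld_integrable lp.
have [|c hc] := du_bois_reymond lp lq _ AQ.
  move=> eta he ea eb; have Xa := ts_itv_left; have Xb := ts_itv_right.
  have [Hf Af] := variation_integrable hf hy he.
  have [Hg Ag] := variation_integrable hg hy he.
  have := stat eta he ea eb; rewrite /first_variation (nabla_intE Af)// (nabla_intE Ag)// => E.
  have A := antiderivativeD Af (antiderivativeZ (- lambda) Ag).
  rewrite (@nabla_intE _ (fun t => Hf t + (- lambda) * Hg t))//; first by lra.
  by apply: (eq_antiderivative _ A) => t Kt; rewrite /variation; ring.
(* On [a, b]_kappa this equals [F_v] along [y]; at a right-scattered [a] it supplies the value that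
   makes the derivative at [sigma a] correct. *)
exists (fun t => Q t + c) => [t Kt|].
  by rewrite -Fv// -(hc t Kt); ring.
by apply: eq_antiderivative Fx _; exact: antiderivative_shift.
Qed.

End TimeScale.

Theorem theorem1 (R : realType) (T : set R) (a b alpha beta Lambda : R)
    (f g : R -> R -> R -> R) (y : R -> R)
    (hT : is_time_scale T) (ha : T a) (hb : T b) (hab : a < b)
    (hf : C1_lagrangian T a b f) (hg : C1_lagrangian T a b g)
    (hy : C1 T a b y)
    (hext : local_minimum T a b alpha beta Lambda f g y \/
            local_maximum T a b alpha beta Lambda f g y)
    (hJ : ~ extremal T a b g y) :
  exists lambda : R,
    let F := fun t x v : R => f t x v - lambda * g t x v in
    exists2 Fv : R -> R,
      extends_from_kappa T a b (along T a b (partial_v F) y) Fv &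
      forall t : R, ts_kappa T a b t ->
        nabla_derivable T a b Fv t /\
        nabla T a b Fv t - along T a b (partial_x F) y t = 0.
Proof.
have [eta0 [he0 e0a e0b B0]] := stationary_not_extremal hT ha hb hab hg hy hJ.
have stat := local_extremum_stationary hT ha hb hab hf hg hext he0 e0a e0b B0.
pose lambda := first_variation T a b f y eta0 / first_variation T a b g y eta0.
exists lambda => F.
have [|Fv ext A] := euler_lagrange hT ha hb hab hf hg hy (lambda := lambda).
  move=> eta he ea eb.
  (* [eta - r * eta0] annihilates the first variation of J, hence that of I, so the first variation
     of I at [eta] is [r] times its value at [eta0]. *)
  pose r := first_variation T a b g y eta / first_variation T a b g y eta0.
  have gE : first_variation T a b g y (fun t => eta t + - r * eta0 t) = 0.
    by rewrite first_variation_lin// mulNr /r divfK// subrr.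
  have hl : C1 T a b (fun t => eta t + - r * eta0 t) by exact: C1_lin.
  have := stat _ hl _ _ gE.
  rewrite ea eb e0a e0b !mulr0 !addr0 first_variation_lin// => /(_ erefl erefl) /eqP.
  rewrite mulNr subr_eq0 => /eqP ->.
  by rewrite /r /lambda mulrAC [RHS]mulrAC; congr (_ / _); exact: mulrC.
exists Fv => // t Kt; split; first by eexists; exact: A.
have -> : nabla T a b Fv t = along T a b (partial_x F) y t.
  by apply: nablaE => //; exact: A.
by rewrite subrr.
Qed.
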